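(* Let $u=v^{a,b}$ with $a,b>-1$, let $w=v^{\alpha,\beta}$ with $\alpha,\beta>-1$, and let $u_1,u_2$ be the weights associated to $u$ defined in the context. Let the integers $0<m<n$ be related by $m\approx n$, i.e. $c_1m\le n\le c_2m$ for some constants $c_2\ge c_1>1$ independent of $n$ and $m$. Then for all $f\in B_0(u_1)$ and any $t\in(-1,1)$, $$\mathcal{E}_{n,m}^u(w,f,t)\,u_2(t)\le \mathcal{C}\,|f(t)-V_n^m(w,f,t)|\,u_1(t)+\mathcal{C}\,\|f-V_n^m(w,f)\|_{B_0(u_1)},$$ where $\mathcal{C}>0$ is independent of $n,f,t$. Moreover, if $V_n^m(w):C^0_{u_1}\to C^0_{u_1}$ is a uniformly bounded map with respect to $m\approx n$ (i.e. $\|V_n^m(w,f)u_1\|_\infty\le \mathcal{C}\|fu_1\|_\infty$ for all $f\in C^0_{u_1}$ with $\mathcal{C}$ independent of $n,m,f$), then $$\lim_{n\to\infty}\mathcal{E}_{n,m}^u(w,f,t)\,u_2(t)=0,\qquad \forall f\in B_0(u_1)$$ (with $m\approx n$), and the convergence holds uniformly in $t\in(-1,1)$.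
   Context: For real exponents $p,q$ put $v^{p,q}(x):=(1-x)^p(1+x)^q$, $x\in(-1,1)$. For real $c$, $c_+:=\max\{0,c\}$ and $c_-:=\max\{0,-c\}$. Weights: for $u=v^{a,b}$ set $u_+:=v^{a_+,b_+}$, $u_-:=v^{a_-,b_-}$ (so $u=u_+/u_-$), and $$u_1(x):=u_+(x),\qquad u_2(x):=\frac{u_-(x)}{1+(u_+u_-)(-1)\,|\log(1+x)|+(u_+u_-)(1)\,|\log(1-x)|},$$ where $u_+u_-=v^{|a|,|b|}$ is evaluated at $\pm1$ with the convention $0^0=1$ (so $(u_+u_-)(1)\ne0$ iff $a=0$, and $(u_+u_-)(-1)\neq0$ iff $b=0$). Space $C^0_v$ ($v=v^{\gamma,\delta}$, $\gamma,\delta\ge 0$): all functions $f$ continuous on $(-1,1)$ such that $\lim_{x\to 1}f(x)v(x)=0$ if $\gamma>0$ and $\lim_{x\to -1}f(x)v(x)=0$ if $\delta>0$; at an endpoint where the exponent is $0$, $f$ is required to be continuous up to that endpoint. Norm: $\|fv\|_\infty=\max_{x\in[-1,1]}|f(x)|v(x)$ (with $fv$ extended continuously to $[-1,1]$). $\mathbb{P}_n$ is the space of algebraic polynomials of degree at most $n$, and $E_n(f)_v:=\inf_{P\in\mathbb{P}_n}\|(f-P)v\|_\infty$. $B_0(v):=\{f\in C^0_v:\ \sum_{n=1}^\infty \frac{E_n(f)_v}{n+1}<\infty\}$ with norm $\|f\|_{B_0(v)}:=\|fv\|_\infty+\sum_{n=1}^\infty \frac{E_n(f)_v}{n+1}$.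 De la Vallée Poussin (VP) operator: let $p_j(w,\cdot)$ be the orthonormal Jacobi polynomials with respect to $w$ on $[-1,1]$ (positive leading coefficients), $x_1,\dots,x_n$ the zeros of $p_n(w,\cdot)$, and $\lambda_k:=\big(\sum_{j=0}^{n-1}p_j(w,x_k)^2\big)^{-1}$. For integers $0<m<n$, $$V_n^m(w,f,x)=\sum_{k=1}^n f(x_k)\,\lambda_k\sum_{j=0}^{n+m-1}\mu_{n,j}^m\,p_j(w,x)\,p_j(w,x_k),$$ where $\mu_{n,j}^m=1$ for $0\le j\le n-m$ and $\mu_{n,j}^m=\frac{n+m-j}{2m}$ for $n-m<j<n+m$. Finite Hilbert transform (principal value): $$\mathcal{H}^uf(t):=\lim_{\epsilon\to0}\int_{x\in[-1,1],\,|x-t|\ge\epsilon}\frac{f(x)}{x-t}u(x)\,dx,\qquad -1<t<1.$$ VP quadrature rule and its error: $$\mathcal{H}^u_{n,m}(w,f,t):=\mathcal{H}^u[V_n^m(w,f)](t),\qquad \mathcal{E}^u_{n,m}(w,f,t):=\big|\mathcal{H}^uf(t)-\mathcal{H}^u_{n,m}(w,f,t)\big|.$$ *)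

(* Defs.v *)
From HB Require Import structures.
From mathcomp Require Import all_boot all_order all_algebra.
From mathcomp Require Import all_classical all_reals all_analysis.

Set Implicit Arguments.
Unset Strict Implicit.
Unset Printing Implicit Defensive.

Import Order.TTheory GRing.Theory Num.Theory.
Import numFieldNormedType.Exports.

Local Open Scope classical_set_scope.
Local Open Scope ring_scope.

Section Weights.
Context {R : realType}.
Implicit Types a b c x : R.

(* [powR] satisfies 0 `^ 0 = 1 and 0 `^ p = 0 for p != 0 (including p < 0);
   hence for nonnegative exponents [jacobi_weight] is the continuous weight on
   all of [-1, 1], while for negative exponents its values at the endpoints are
   meaningless and only matter up to a null set. *)
Definition jacobi_weight (p q : R) x : R := (1 - x) `^ p * (1 + x) `^ q.

Definition pos_part c : R := Num.max 0 c.
Definition neg_part c : R := Num.max 0 (- c).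

Definition u_plus a b : R -> R := jacobi_weight (pos_part a) (pos_part b).
Definition u_minus a b : R -> R := jacobi_weight (neg_part a) (neg_part b).

Definition u_one a b : R -> R := u_plus a b.
Definition u_two a b x : R :=
  u_minus a b x /
    (1 + u_plus a b (-1) * u_minus a b (-1) * `|ln (1 + x)|
       + u_plus a b 1 * u_minus a b 1 * `|ln (1 - x)|).

End Weights.

Section Spaces.
Context {R : realType}.
Variables gamma delta : R.
Implicit Type f : R -> R.

(* The space C^0_v for v = v^{gamma, delta}, gamma, delta >= 0.  Elements are
   total functions of which only the values on [-1, 1] matter: when an exponent
   is 0, the value of f at that endpoint is its continuous extension; when it
   is positive, that value is arbitrary, and since v vanishes there the product
   f v automatically takes the value 0 of its continuous extension. *)
Definition C0_space : set (R -> R) := [set f : R -> R |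
  [/\ {in `](-1 : R), 1[, continuous f},
      (if 0 < gamma then f x * jacobi_weight gamma delta x @[x --> 1^'-] --> 0
       else f x @[x --> 1^'-] --> f 1) &
      (if 0 < delta then
         f x * jacobi_weight gamma delta x @[x --> (-1)^'+] --> 0
       else f x @[x --> (-1)^'+] --> f (-1))]].

Definition weighted_norm f : R :=
  sup [set `|f x| * jacobi_weight gamma delta x | x in `[-1, 1]].

Definition best_approx (n : nat) f : R :=
  inf [set weighted_norm (fun x => f x - P.[x]) |
        P in [set P : {poly R} | (size P <= n.+1)%N]].

Definition best_approx_sum f : R ^nat :=
  [sequence \sum_(1 <= k < n) best_approx k f / k.+1%:R]_n.

Definition B0_space : set (R -> R) :=
  [set f | C0_space f /\ cvgn (best_approx_sum f)].

Definition B0_norm f : R := weighted_norm f + limn (best_approx_sum f).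

End Spaces.

Section DeLaValleePoussin.
Context {R : realType}.

Definition orthonormal_jacobi (alpha beta : R) (p : nat -> {poly R}) : Prop :=
  [/\ forall j, size (p j) = j.+1,
      forall j, 0 < lead_coef (p j) &
      forall i j,
        (\int[lebesgue_measure]_(x in `[-1, 1])
           ((p i).[x] * (p j).[x] * jacobi_weight alpha beta x))%R
        = (i == j)%:R].

Variable p : nat -> {poly R}.

Definition christoffel (n : nat) (y : R) : R :=
  (\sum_(j < n) (p j).[y] ^+ 2)^-1.

Definition vp_coef (n m j : nat) : R :=
  if (j <= n - m)%N then 1 else (n + m - j)%N%:R / (2 * m)%N%:R.

(* The zeros of [p n] are n distinct points of ]-1, 1[, so the sum over its
   zero set is the sum over x_1, ..., x_n. *)
Definition vp_operator (n m : nat) (f : R -> R) (x : R) : R :=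
  \sum_(y \in [set y | root (p n) y])
    (f y * christoffel n y *
       \sum_(j < n + m) (vp_coef n m j * (p j).[x] * (p j).[y])).

End DeLaValleePoussin.

Section HilbertTransform.
Context {R : realType}.
Variables a b : R.

Definition finite_hilbert (f : R -> R) (t : R) : R :=
  lim ((\int[lebesgue_measure]_(x in
          [set x | x \in `[-1, 1] /\ eps <= `|x - t|])
            (f x / (x - t) * jacobi_weight a b x))%R @[eps --> 0^'+]).

Variable p : nat -> {poly R}.

Definition vp_quadrature (n m : nat) (f : R -> R) (t : R) : R :=
  finite_hilbert (vp_operator p n m f) t.

Definition vp_error (n m : nat) (f : R -> R) (t : R) : R :=
  `|finite_hilbert f t - vp_quadrature n m f t|.

End HilbertTransform.

Definition vp_related {R : realType} (c1 c2 : R) (n m : nat) : Prop :=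
  [/\ (0 < m)%N, (m < n)%N, c1 * m%:R <= n%:R & n%:R <= c2 * m%:R].

(* Main.v *)
(** The Hilbert transform is bounded from [B_0(u_1)] into [C^0_{u_2}], so the
    quadrature error, which is the Hilbert transform of [g = f - V_n^m f], is
    bounded by [||g||_{B_0(u_1)}] alone.  For this bound let [P_k] be
    near-best approximations of [g] of degree [2^k], with errors [e_k]; then
    [sum e_k] is at most a constant times the norm.

    Near the singularity, for [|x - t| <= h = (1 - |t|) / 2], the weights are
    comparable to their values at [t].  Pairing the annulus
    [|x - t| ~ h 4^-k] with [P_k] and using Markov's inequality (in [4^k], the
    square of the degree) for the differences [P_j - P_{j-1}], the oscillation
    of [g u] there is [e_k] plus a geometric convolution of the [e_j], which is
    summable: this gives the existence of the principal value and its bound.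
    Far from the singularity the integral is estimated in absolute value.  At an
    endpoint where the exponent of [u] is positive, Markov's inequality again
    yields a summable decay of [g u_1] on the scales [1 - x ~ 4^-k]; otherwise
    the integral is the one that [u_2], with its logarithm, compensates.

    For the convergence, Gauss quadrature makes [V_n^m] reproduce polynomials of
    degree [n - m], hence [||g u_1|| <= C E_{n-m}(f)] and
    [||g||_{B_0} <= C E_{n-m}(f) log n + sum_{k >= n} E_k(f) / k], which tends
    to [0] because [E_k(f)] decreases and [sum E_k(f) / k] converges. *)
Require Import Defs.
From HB Require Import structures.
From mathcomp Require Import all_boot all_order all_algebra.
From mathcomp Require Import all_classical all_reals all_analysis.
From mathcomp Require Import measurable_realfun ring lra.
From mathcomp Require polyrcf.

Set Implicit Arguments.
Unset Strict Implicit.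
Unset Printing Implicit Defensive.

Import Order.TTheory GRing.Theory Num.Theory.
Import numFieldNormedType.Exports.

Local Open Scope classical_set_scope.
Local Open Scope ring_scope.

(** * Markov's inequality *)

(** Membership in the space amounts to summability of the errors at degrees 2^k, a Dini condition on
    a logarithmic scale, so no step may lose a factor that grows with k. This is possible because dx
    / |x - c| gives an annulus of fixed ratio q a mass that does not depend on its radius. The radii
    can therefore shrink like 4^-k rather than 2^-k at no cost, and the squared degree in Markov's
    inequality, used on an interval comparable to the distance from t to the endpoints, is cancelled
    exactly. At an endpoint the squared degree is the natural order, so the same scales serve there.
    Earlier differences enter with weights q^(k-j), and convolution with a geometric sequence
    preserves summability. All constants have to be uniform in g and t. The analytic estimates are
    therefore stated for abstract data (polynomials, errors, a supremum bound and a sum), and the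
    norm enters only at the end. *)

Fixpoint chebyshev_pair (R : realType) (n : nat) : {poly R} * {poly R} :=
  if n is k.+1 then
    let: (s, r) := chebyshev_pair R k in (r, 'X * r *+ 2 - s)
  else (1, 'X).

(** Chebyshev polynomials T_n of the first kind; carrying the pair (T_n, T_(n+1)) makes the two-term
    recurrence structural. *)
Definition chebyshev (R : realType) (n : nat) : {poly R} :=
  (chebyshev_pair R n).1.

Lemma chebyshevSS (R : realType) n :
  chebyshev R n.+2 = 'X * chebyshev R n.+1 *+ 2 - chebyshev R n.
Proof. by rewrite /chebyshev /=; case: chebyshev_pair. Qed.

Lemma nat_ind2 (P : nat -> Prop) : P 0%N -> P 1%N ->
  (forall n, P n -> P n.+1 -> P n.+2) -> forall n, P n.
Proof.
move=> P0 P1 PS n; suff: P n /\ P n.+1 by case.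
by elim: n => [|n [Pn PSn]]; split => //; exact: PS.
Qed.

Lemma size_chebyshev (R : realType) n : (size (chebyshev R n) <= n.+1)%N.
Proof.
elim/nat_ind2: n => [||n IH0 IH1]; first by rewrite size_poly1.
  by rewrite /chebyshev /= size_polyX.
rewrite chebyshevSS (leq_trans (size_polyD _ _)) // geq_max size_polyN.
have -> /= : (size (chebyshev R n) <= n.+3)%N by rewrite (leq_trans IH0) // ltnW.
rewrite andbT.
rewrite -scaler_nat (leq_trans (size_scale_leq _ _)) //.
by rewrite (leq_trans (size_polyMleq _ _)) // size_polyX.
Qed.

Lemma chebyshev_cos (R : realType) n (x : R) :
  (chebyshev R n).[cos x] = cos (n%:R * x).
Proof.
elim/nat_ind2: n => [||n IH0 IH1].
- by rewrite mul0r cos0 hornerC.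
- by rewrite mul1r /chebyshev /= hornerX.
rewrite chebyshevSS hornerD hornerN mulr2n hornerD hornerM hornerX IH0 IH1.
have -> : n.+2%:R * x = n.+1%:R * x + x :> R by rewrite -!natr1; ring.
have -> : n%:R * x = n.+1%:R * x - x :> R by rewrite -!natr1; ring.
rewrite cosB cosD; ring.
Qed.

Lemma chebyshev1 (R : realType) n : (chebyshev R n).[1] = 1.
Proof. by rewrite -cos0 chebyshev_cos mulr0. Qed.

Lemma deriv_chebyshev1 (R : realType) n : (chebyshev R n)^`().[1] = n%:R ^+ 2.
Proof.
elim/nat_ind2: n => [||n IH0 IH1].
- by rewrite derivC hornerC expr0n.
- by rewrite /chebyshev /= derivX hornerC expr1n.
rewrite chebyshevSS derivB derivMn derivM derivX mul1r.
rewrite hornerD hornerN mulr2n 2!hornerD hornerM hornerX IH0 IH1.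
rewrite !chebyshev1 -!natr1; ring.
Qed.

Lemma deriv_prod_XsubC_ge0 (R : realType) (rs : seq R) (x : R) :
  all (fun r => r < x) rs ->
  0 < (\prod_(r <- rs) ('X - r%:P)).[x] /\
  0 <= (\prod_(r <- rs) ('X - r%:P))^`().[x].
Proof.
elim: rs => [_|r rs IH /=]; first by rewrite big_nil derivC !hornerC.
case/andP => rx /IH [h1 h2]; rewrite big_cons derivM derivXsubC mul1r.
rewrite hornerD !hornerM hornerXsubC; split.
  by rewrite mulr_gt0 // subr_gt0.
by rewrite addr_ge0 ?mulr_ge0 ?subr_ge0 // ltW.
Qed.

(* At the extrema of T_N the difference T_N - Q keeps the alternating signs of
   T_N, so all its N roots are real and smaller than 1. *)
Lemma deriv1_le_chebyshev (R : realType) (N : nat) (Q : {poly R}) :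
  (size Q <= N.+1)%N -> (forall x, -1 <= x <= 1 -> `|Q.[x]| < 1) ->
  Q^`().[1] <= N%:R ^+ 2.
Proof.
case: N => [|N] sQ bQ.
  by rewrite (size1_polyC sQ) derivC hornerC exprn_ge0.
pose y k : R := cos (k%:R * (pi / N.+1%:R)).
pose D := chebyshev R N.+1 - Q.
have ydec k : (k < N.+1)%N -> y k.+1 < y k.
  move=> kN; rewrite ltr_cos.
  - by rewrite ltr_pM2r ?divr_gt0 ?pi_gt0 // ltr_nat.
  - rewrite in_itv /= mulr_ge0 ?divr_ge0 ?pi_ge0 //=.
    by rewrite mulrCA ler_piMr ?pi_ge0 // ler_pdivrMr // mul1r ler_nat ltnW.
  - rewrite in_itv /= mulr_ge0 ?divr_ge0 ?pi_ge0 //=.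
    by rewrite mulrCA ler_piMr ?pi_ge0 // ler_pdivrMr // mul1r ler_nat.
have y1 k : -1 <= y k <= 1 by rewrite cos_geN1 cos_le1.
have cosk k : cos (k%:R * pi) = (-1) ^+ k :> R.
  elim: k => [|k IH]; first by rewrite mul0r cos0.
  by rewrite -natr1 mulrDl mul1r cosDpi IH exprS mulN1r.
have Dy k : 0 < D.[y k] * (-1) ^+ k.
  rewrite /D hornerD hornerN chebyshev_cos mulrCA.
  rewrite [_ * (pi / _)]mulrCA divff ?pnatr_eq0 // mulr1 cosk.
  rewrite mulrBl -expr2 sqrr_sign subr_gt0.
  apply: le_lt_trans (ler_norm _) _.
  by rewrite normrM normrX normrN1 expr1n mulr1 bQ.
(* Induction on the number k of intervals already treated: the roots found so far lie in ]y k,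
   1[, so the one found in ]y (k+1), y k[ is new. *)
have [rs [srs urs rts ars]] : exists rs : seq R,
    [/\ size rs = N.+1, uniq rs, all (root D) rs
      & all (fun r => y N.+1 < r < 1) rs].
  elim: {-2}N.+1 (leqnn N.+1) => [|k IH] kN; first by exists nil.
  have [rs [srs urs rts ars]] := IH (ltnW kN).
  have [r /andP[r1 r2] rD] : exists2 r, y k.+1 <= r <= y k & root D r.
    have [ek|ok] := boolP (odd k).
      have [] := @poly_ivt R (- D) (y k.+1) (y k); first exact/ltW/ydec.
        have := Dy k.+1; have := Dy k; rewrite exprS -[(-1) ^+ k]signr_odd ek /=.
        by rewrite !hornerN; lra.
      by move=> r hr; rewrite rootN; exists r.
    have [] := @poly_ivt R D (y k.+1) (y k); first exact/ltW/ydec.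
      have := Dy k.+1; have := Dy k; rewrite exprS -[(-1) ^+ k]signr_odd (negbTE ok) /=.
      lra.
    by move=> r hr; exists r.
  have nr j : r != y j.
    by apply/eqP => rj; move: rD (Dy j) => /rootP; rewrite rj => ->; lra.
  have {}r1 : y k.+1 < r by rewrite lt_neqAle r1 eq_sym nr.
  have {}r2 : r < y k by rewrite lt_neqAle r2 nr.
  exists (r :: rs); split => //=.
  - by rewrite srs.
  - rewrite urs andbT; apply/negP => /(allP ars) /andP[].
    by rewrite ltNge (ltW r2).
  - by rewrite rD rts.
  - rewrite r1 (lt_le_trans r2) /=; last by case/andP: (y1 k).
    apply/allP => x /(allP ars) /andP[h1 ->].
    by rewrite (lt_trans _ h1) ?ydec.
have D1 : 0 < D.[1].
  have := Dy 0%N; rewrite expr0 mulr1 /y mul0r cos0; exact.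
have D0 : D != 0 by apply: contraTneq D1 => ->; rewrite horner0 ltxx.
have sD : size D = (size rs).+1.
  apply/eqP; rewrite eqn_leq max_poly_roots // andbT srs.
  by rewrite (leq_trans (size_polyD _ _)) // geq_max size_polyN size_chebyshev.
(* D is its leading coefficient times a product of factors with roots left of 1. The sign of D(1)
   makes the coefficient positive, so D'(1) >= 0. *)
have := all_roots_prod_XsubC sD rts; rewrite uniq_rootsE => /(_ urs) DE.
have [|q1 q2] := @deriv_prod_XsubC_ge0 R rs 1.
  by apply: sub_all ars => r /andP[].
have : 0 <= D^`().[1].
  rewrite DE derivZ hornerZ mulr_ge0 //.
  by move: D1; rewrite {1}DE hornerZ pmulr_lgt0 // => /ltW.
by rewrite /D derivB hornerD hornerN deriv_chebyshev1 subr_ge0.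
Qed.

Lemma poly_deriv1_le (R : realType) (N : nat) (M : R) (Q : {poly R}) :
  (size Q <= N.+1)%N -> (forall x, -1 <= x <= 1 -> `|Q.[x]| <= M) ->
  `|Q^`().[1]| <= N%:R ^+ 2 * (2 * M).
Proof.
move=> sQ bQ.
have M0 : 0 <= M by apply: le_trans (bQ 0 _) => //; lra.
apply/ler_addgt0Pr => e e0.
(* The scaling must make the bound on Q strictly less than 1, and K must stay positive when M = 0;
   the contribution of e is at most e. *)
pose K := 2 * M + e / (N%:R ^+ 2 + 1).
have N2 : 0 <= N%:R ^+ 2 :> R by rewrite exprn_ge0.
have e'0 : 0 < e / (N%:R ^+ 2 + 1) by rewrite divr_gt0 // ltr_wpDl.
have K0 : 0 < K by rewrite ltr_wpDl // mulr_ge0.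
have le2 (c : R) : `|c| = 1 -> c * Q^`().[1] <= N%:R ^+ 2 * K.
  move=> c1; have := @deriv1_le_chebyshev R N ((c / K) *: Q).
  rewrite derivZ hornerZ mulrAC ler_pdivrMr //; apply.
    by rewrite (leq_trans (size_scale_leq _ _)).
  move=> x /bQ Qx; rewrite hornerZ !normrM c1 mul1r normfV (gtr0_norm K0).
  by rewrite mulrC ltr_pdivrMr // mul1r (le_lt_trans Qx) // /K; lra.
have : `|Q^`().[1]| <= N%:R ^+ 2 * K.
  rewrite ler_norml; have := le2 1; have := le2 (-1).
  by rewrite normrN1 normr1 => /(_ erefl) + /(_ erefl); lra.
move=> /le_trans; apply; rewrite /K mulrDr lerD2l mulrCA ger_pMr //.
by rewrite ler_pdivrMr ?mul1r ?lerDl // ltr_wpDl.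
Qed.

(** The affine map A with A(1) = x and A(-1) = e, the endpoint of [c, d] farther from x, stays
    inside [c, d], so the bound at 1 yields one at x. Since |x - e| >= (d - c) / 2, the chain rule
    turns the factor 2 into 8 / (d - c). *)
Lemma poly_deriv_le (R : realType) (N : nat) (M c d : R) (Q : {poly R}) :
  (size Q <= N.+1)%N -> c < d -> (forall x, c <= x <= d -> `|Q.[x]| <= M) ->
  forall x, c <= x <= d -> `|Q^`().[x]| <= 8 * N%:R ^+ 2 * M / (d - c).
Proof.
move=> sQ cd bQ x xcd.
have M0 : 0 <= M by apply: le_trans (bQ x _).
have [e ecd xe] : exists2 e, c <= e <= d & (d - c) / 2 <= `|x - e|.
  have [h|h] := leP ((c + d) / 2) x.
    exists c; [by lra|rewrite ger0_norm; lra].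
  exists d; [by lra|rewrite distrC ger0_norm; lra].
have xe0 : 0 < `|x - e| by apply: lt_le_trans xe; lra.
pose A : {poly R} := ((x - e) / 2) *: 'X + ((x + e) / 2)%:P.
have sA : (size A <= 2)%N.
  rewrite (leq_trans (size_polyD _ _)) // geq_max.
  rewrite (leq_trans (size_scale_leq _ _)) ?size_polyX //=.
  by rewrite (leq_trans (size_polyC_leq1 _)).
have := @poly_deriv1_le R N M (Q \Po A) _ _.
rewrite deriv_comp hornerM horner_comp.
have -> : A.[1] = x by rewrite /A !hornerE; lra.
have -> : A^`().[1] = (x - e) / 2.
  by rewrite /A derivD derivZ derivX derivC !hornerE.
move=> H; have {}H : `|Q^`().[x] * ((x - e) / 2)| <= N%:R ^+ 2 * (2 * M).
  apply: H.
    apply: leq_trans (size_comp_poly_leq _ _) _.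
    by rewrite ltnS -[N]muln1 leq_mul // -subn1 leq_subLR.
  move=> z z1; rewrite horner_comp bQ // /A !hornerE.
  apply/andP; split; nra.
rewrite ler_pdivlMr ?subr_gt0 //.
rewrite normrM normrM (_ : `|2^-1| = 2^-1) in H; last by rewrite gtr0_norm.
have : `|Q^`().[x]| * ((d - c) / 2 / 2) <= N%:R ^+ 2 * (2 * M).
  apply: le_trans H; rewrite ler_wpM2l //; lra.
lra.
Qed.

Lemma poly_lipschitz (R : realType) (N : nat) (M c d : R) (Q : {poly R}) :
  (size Q <= N.+1)%N -> c < d -> (forall x, c <= x <= d -> `|Q.[x]| <= M) ->
  forall x y, c <= x <= d -> c <= y <= d ->
  `|Q.[x] - Q.[y]| <= 8 * N%:R ^+ 2 * M / (d - c) * `|x - y|.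
Proof.
move=> sQ cd bQ x y.
wlog xy : x y / y < x => [hw hx hy|].
  have [/hw|/hw|->] := ltgtP y x; first exact.
    by rewrite distrC [X in _ * X]distrC; apply.
  by rewrite !subrr normr0 mulr0.
move=> hx hy; have [z /andP[z1 z2] ->] := polyrcf.poly_mvt Q xy.
rewrite normrM ler_wpM2r //; apply: poly_deriv_le => //.
by move: hx hy z1 z2; rewrite !bnd_simp; lra.
Qed.

(** * Integrals over dyadic annuli *)

Section dyadic.
Context (R : realType).
Notation mu := (@lebesgue_measure R).

Definition annulus (c h q : R) (k : nat) : set R :=
  [set x | h * q ^+ k.+1 < `|x - c| <= h * q ^+ k].

Lemma measurable_normB_itv (c : R) (i : interval R) :
  measurable [set x : R | `|x - c| \in i].
Proof.
rewrite -[X in measurable X]setTI.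
have mf : measurable_fun setT (fun x : R => `|x - c|).
  apply: measurableT_comp => //; exact: measurable_funD.
exact: (mf measurableT _ (measurable_itv i)).
Qed.

Lemma measurable_annulus c h q k : measurable (annulus c h q k).
Proof.
rewrite [annulus _ _ _ _](_ : _ =
  [set x | `|x - c| \in `]h * q ^+ k.+1, h * q ^+ k]]).
  exact: measurable_normB_itv.
by apply/seteqP; split => x /=; rewrite in_itv.
Qed.

Lemma bigcup_annulus c h q : 0 < q < 1 -> 0 < h ->
  [set x | 0 < `|x - c| <= h] `<=` \bigcup_k annulus c h q k.
Proof.
move=> /andP[q0 q1] h0 x /= /andP[x0 xh].
have [k kP] : exists k, h * q ^+ k < `|x - c|.
  have : q ^+ n @[n --> \oo] --> 0 by apply: cvg_expr; rewrite gtr0_norm.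
  move/cvgrPdist_lt => /(_ (`|x - c| / h)) [|N _ /(_ N (leqnn N))].
    by rewrite divr_gt0.
  rewrite sub0r normrN ger0_norm ?exprn_ge0 ?ltW // ltr_pdivlMr // mulrC => ?.
  by exists N.
(* The least such k is positive because |x - c| <= h; its predecessor is the index of the
   annulus. *)
have ek : exists k, h * q ^+ k < `|x - c| by exists k.
case: (ex_minnP ek) => -[|m] mP mmin.
  by move: mP; rewrite expr0 mulr1 ltNge xh.
exists m => //=; rewrite /annulus /= mP leNgt /=.
by apply/negP => /mmin; rewrite ltnn.
Qed.

Lemma trivIset_annulus c h q : 0 < q < 1 -> 0 < h ->
  trivIset setT (annulus c h q).
Proof.
move=> /andP[q0 q1] h0; apply/trivIsetP => i j _ _.
wlog ij : i j / (i < j)%N.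
  move=> hw; rewrite neq_ltn => /orP[|] ij; first by rewrite hw ?ltn_eqF.
  by rewrite setIC hw ?ltn_eqF.
move=> _; rewrite -subset0 => x [] /= /andP[+ _] /andP[_].
rewrite ltNge => /negP + xj; apply; apply: le_trans xj _.
by rewrite ler_pM2l // ler_wiXn2l // ltW.
Qed.

Lemma lebesgue_annulus_le c h q k : 0 < q < 1 -> 0 < h ->
  (mu (annulus c h q k) <= (2 * (h * q ^+ k))%:E)%E.
Proof.
move=> /andP[q0 q1] h0.
have hq : 0 < h * q ^+ k by rewrite mulr_gt0 // exprn_gt0.
apply: (@le_trans _ _ (mu `[c - h * q ^+ k, c + h * q ^+ k])).
  apply: le_measure; rewrite ?inE //; first exact: measurable_annulus.
  by move=> x /= /andP[_]; rewrite ler_distl in_itv.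
rewrite lebesgue_measure_itv /= lte_fin ifT; last by lra.
by rewrite -EFinB lee_fin; lra.
Qed.

(** The k-th annulus has measure at most 2 h q^k, and |K| is at most cc_k / (h q^(k+1)) on it. The
    radius cancels, and the annulus contributes at most (2 / q) cc_k. *)
Lemma dyadic_integrable (A : set R) (K : R -> R) (c h q S : R)
    (cc : nat -> R) :
  measurable A -> measurable_fun A K -> 0 < q < 1 -> 0 < h ->
  (forall x, A x -> 0 < `|x - c| <= h) ->
  (forall k x, A x -> h * q ^+ k.+1 < `|x - c| <= h * q ^+ k ->
     `|K x| <= cc k / `|x - c|) ->
  (forall k, 0 <= cc k) -> (forall n, \sum_(k < n) cc k <= S) ->
  mu.-integrable A (EFin \o K) /\
  \int[mu]_(x in A) `|K x| <= 2 / q * S.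
Proof.
move=> mA mK q01 h0 Ah AK cc0 ccS; have /andP[q0 q1] := q01.
have bound : (\int[mu]_(x in A) `|(EFin \o K) x| <= (2 / q * S)%:E)%E.
  have AE : A = \bigcup_k (A `&` annulus c h q k).
    rewrite -setI_bigcupr; apply/esym/setIidPl => x /Ah.
    exact: bigcup_annulus.
  have mAk k : measurable (A `&` annulus c h q k).
    by apply: measurableI => //; exact: measurable_annulus.
  have mEK : measurable_fun A (fun x => `|(EFin \o K) x|%E).
    by do 2 apply: measurableT_comp => //.
  rewrite AE ge0_integral_bigcup //; last first.
  - by apply: trivIset_setIl; exact: trivIset_annulus.
  - by rewrite -AE.
  have S0 : 0 <= S by have := ccS 0%N; rewrite big_ord0.
  have step k : (\int[mu]_(x in A `&` annulus c h q k) `|(EFin \o K) x| <=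
      (2 / q * cc k)%:E)%E.
    have hqk : 0 < h * q ^+ k by rewrite mulr_gt0 // exprn_gt0.
    have hqk1 : 0 < h * q ^+ k.+1 by rewrite mulr_gt0 // exprn_gt0.
    apply: (@le_trans _ _ ((cc k / (h * q ^+ k.+1))%:E
        * mu (A `&` annulus c h q k))%E).
      apply: integral_le_bound => //.
      - exact: mAk.
      - apply: (measurable_funS mA); first exact: subIsetl.

        exact: measurableT_comp.
      - by rewrite lee_fin divr_ge0 // ltW.
      - apply: aeW => x [Ax xk]; rewrite lee_fin (le_trans (AK k x Ax xk)) //.
        case/andP: xk => xk _; rewrite ler_wpM2l // lef_pV2 ?posrE //.
          exact: ltW.
        exact: lt_trans xk.
    apply: (@le_trans _ _ ((cc k / (h * q ^+ k.+1))%:E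
        * (2 * (h * q ^+ k))%:E)%E).
      apply: lee_wpmul2l; first by rewrite lee_fin divr_ge0 // ltW.
      apply: le_trans (lebesgue_annulus_le c k q01 h0).
      apply: le_measure; rewrite ?inE; first exact: mAk.
        exact: measurable_annulus.
      exact: subIsetr.
    rewrite -EFinM lee_fin exprS le_eqVlt; apply/orP; left; apply/eqP.
    by field; rewrite !gt_eqF ?exprn_gt0.
  apply: lime_le; first by apply: is_cvg_nneseries => n _ _; exact: integral_ge0.
  near=> n; rewrite big_mkord.
  apply: (@le_trans _ _ (\sum_(k < n) (2 / q * cc k)%:E)%E).
    by apply: lee_sum => k _.
  rewrite sumEFin lee_fin -mulr_sumr ler_wpM2l //.
  by rewrite divr_ge0 // ltW.
split.
  apply/integrableP; split; first exact/measurable_EFinP.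
  by apply: le_lt_trans bound _; rewrite ltry.
rewrite /Rintegral -[leRHS]/(fine (2 / q * S)%:E); apply: fine_le => //.
rewrite ge0_fin_numE ?integral_ge0 //.
by apply: le_lt_trans bound _; rewrite ltry.
Unshelve. all: by end_near. Qed.
End dyadic.

(** * Jacobi weights *)

Section weights.
Context (R : realType).
Implicit Types (p q x t a b : R).

Lemma normr_expRB1 x : `|expR x - 1| <= `|x| * expR `|x|.
Proof.
have h : 1 - x <= expR (- x) by exact: expR_ge1Dx.
have e0 : 0 < expR x := expR_gt0 x.
have h1 := expR_ge1Dx x.
have h2 : expR x - 1 <= x * expR x.
  have : (1 - x) * expR x <= 1.
    by rewrite -[leRHS](expRxMexpNx_1 x) mulrC ler_pM2l.
  lra.
have [x0|x0] := leP 0 x.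
  by rewrite (ger0_norm x0) ger0_norm; lra.
have e1 : expR x < 1 by rewrite expR_lt1.
have n1 : 1 <= expR (- x) by have := expR_ge1Dx (- x); lra.
rewrite (ltr0_norm x0) ltr0_norm; nra.
Qed.

Lemma normr_ln_le r : 2^-1 <= r -> `|ln r| <= 2 * `|r - 1| :> R.
Proof.
move=> r2; have r0 : 0 < r by lra.
have h1 : ln r <= r - 1.
  by have := @le_ln1Dx R (r - 1); rewrite subrKC; apply; lra.
have h2 : - ln r <= (1 - r) / r.
  rewrite -lnV ?posrE //; have := @le_ln1Dx R (r^-1 - 1).
  rewrite subrKC mulrBl divff ?gt_eqF // mul1r; apply.
  by rewrite ltrBrDr addNr invr_gt0.
have [r1|r1] := leP 1 r.
  by rewrite [`|ln _|]ger0_norm ?ln_ge0 // ger0_norm; lra.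
have l0 : ln r <= 0 by apply: ln_le0; exact: ltW.
rewrite (ler0_norm l0) ltr0_norm ?subr_lt0 //.
apply: le_trans h2 _; rewrite ler_pdivrMr //; nra.
Qed.

Definition powR_lip_cst p : R := 2 * `|p| * expR `|p|.

Lemma powR_lip_cst_ge0 p : 0 <= powR_lip_cst p.
Proof. by rewrite mulr_ge0 ?expR_ge0 // mulr_ge0. Qed.

(** Write A^p = B^p exp(p ln(A / B)). Since A / B >= 1/2, |ln(A / B)| <= 2 |A / B - 1| <= 1, so the
    exponent is at most |p| in absolute value. *)
Lemma powR_lipschitz p (A B : R) : 0 < B -> `|A - B| <= B / 2 ->
  `|A `^ p - B `^ p| <= powR_lip_cst p * B `^ p * (`|A - B| / B).
Proof.
move=> B0 AB; have A0 : B / 2 <= A by move: AB; rewrite ler_norml; lra.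
have r2 : 2^-1 <= A / B by rewrite ler_pdivlMr //; lra.
have r1 : `|A / B - 1| = `|A - B| / B.
  by rewrite -{1}(divff (lt0r_neq0 B0)) -mulrBl normrM normfV (gtr0_norm B0).
have -> : A `^ p = B `^ p * expR (p * ln (A / B)).
  rewrite -{1}(divfK (lt0r_neq0 B0) A) powRM; [|by rewrite divr_ge0 //; lra|lra].
  by rewrite mulrC {2}/powR gt_eqF //; lra.
rewrite -{2}[B `^ p]mulr1 -mulrBr normrM (ger0_norm (powR_ge0 _ _)).
rewrite [X in _ <= X * _]mulrC -mulrA ler_wpM2l ?powR_ge0 //.
apply: le_trans (normr_expRB1 _) _.
have h := normr_ln_le r2; rewrite r1 in h.
have d2 : `|A - B| / B <= 2^-1 by rewrite ler_pdivrMr //; lra.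
have h3 : `|p * ln (A / B)| <= `|p|.
  by rewrite normrM -[leRHS]mulr1 ler_wpM2l //; lra.
rewrite /powR_lip_cst.
have -> : 2 * `|p| * expR `|p| * (`|A - B| / B) =
  (`|p| * (2 * (`|A - B| / B))) * expR `|p| by ring.
apply: ler_pM; rewrite ?expR_ge0 ?ler_expR //.
by rewrite normrM ler_wpM2l.
Qed.

(** If two factors have relative errors P and Q, their product has relative error at most P (1 + Q)
    + Q, which is below (1 + P) (1 + Q). *)
Definition weight_cst p q : R :=
  (1 + powR_lip_cst p) * (1 + powR_lip_cst q).

Lemma weight_cst_ge1 p q : 1 <= weight_cst p q.
Proof.
have := powR_lip_cst_ge0 p; have := powR_lip_cst_ge0 q; rewrite /weight_cst.
nra.
Qed.

Definition half_gap t : R := (1 - `|t|) / 2.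

Lemma half_gap_gt0 t : -1 < t < 1 -> 0 < half_gap t.
Proof.
move=> t1; have : `|t| < 1 by rewrite ltr_norml.
by rewrite /half_gap; lra.
Qed.

Lemma half_gapP t : half_gap t <= (1 - t) / 2 /\ half_gap t <= (1 + t) / 2.
Proof.
have := ler_norm t; have := ler_norm (- t); rewrite normrN /half_gap.
by split; lra.
Qed.

Lemma half_gap_itv t x : -1 < t < 1 -> `|x - t| <= half_gap t -> -1 < x < 1.
Proof.
move=> t1; have [h1 h2] := half_gapP t; rewrite ler_norml => /andP[h3 h4].
by apply/andP; split; lra.
Qed.

Lemma jacobi_weight_gt0 p q x : -1 < x < 1 -> 0 < jacobi_weight p q x.
Proof. by move=> x1; rewrite mulr_gt0 // powR_gt0; lra. Qed.

Lemma jacobi_weight_ge0 p q x : 0 <= jacobi_weight p q x.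
Proof. by rewrite mulr_ge0 // powR_ge0. Qed.

(** A move of at most [half_gap t] changes each of 1 - t and 1 + t by at most half of itself, so
    [powR_lipschitz] applies to both factors of the weight. *)
Lemma jacobi_weight_near p q t x : -1 < t < 1 -> `|x - t| <= half_gap t ->
  jacobi_weight p q x <= weight_cst p q * jacobi_weight p q t /\
  `|jacobi_weight p q x - jacobi_weight p q t| <=
    weight_cst p q * jacobi_weight p q t * (`|x - t| / half_gap t).
Proof.
move=> t1 xt; have h0 := half_gap_gt0 t1; have [g1 g2] := half_gapP t.
have key r (s A B : R) : 0 < B -> `|A - B| = `|x - t| -> half_gap t <= B / 2 ->
    `|A `^ r - B `^ r| <= powR_lip_cst r * B `^ r * (`|x - t| / half_gap t).
  move=> B0 ABE hB; apply: le_trans (powR_lipschitz _ B0 _) _.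
    by rewrite ABE (le_trans xt).
  rewrite ABE; apply: ler_wpM2l.
    by rewrite mulr_ge0 ?powR_ge0 ?powR_lip_cst_ge0.
  by apply: ler_wpM2l => //; rewrite lef_pV2 ?posrE //; lra.
have k1 : `|(1 - x) `^ p - (1 - t) `^ p| <=
    powR_lip_cst p * (1 - t) `^ p * (`|x - t| / half_gap t).
  apply: key => //; [by lra|rewrite -normrN; congr `|_|; ring].
have k2 : `|(1 + x) `^ q - (1 + t) `^ q| <=
    powR_lip_cst q * (1 + t) `^ q * (`|x - t| / half_gap t).
  apply: key => //; [by lra|congr `|_|; ring].
have p0 := powR_lip_cst_ge0 p; have q0 := powR_lip_cst_ge0 q.
set dd := `|x - t| / half_gap t in k1 k2 *.
have d0 : 0 <= dd by rewrite divr_ge0 // ltW.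
have d1 : dd <= 1 by rewrite ler_pdivrMr // mul1r.
have B1 := powR_ge0 (1 - t) p; have B2 := powR_ge0 (1 + t) q.
have A1 := powR_ge0 (1 - x) p; have A2 := powR_ge0 (1 + x) q.
rewrite /weight_cst /jacobi_weight.
move: k1 k2 d0 d1 B1 B2 A1 A2 p0 q0.
move: ((1 - x) `^ p) ((1 - t) `^ p) ((1 + x) `^ q) ((1 + t) `^ q).
move: (powR_lip_cst p) (powR_lip_cst q) dd.
move=> P Q D A1 B1 A2 B2 k1 k2 D0 D1 b1 b2 a1 a2 P0 Q0.
have l1 : A1 <= (1 + P) * B1.
  have : A1 - B1 <= P * B1 * D by apply: le_trans k1; exact: ler_norm.
  have : P * B1 * D <= P * B1 by rewrite ler_piMr ?mulr_ge0.
  lra.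
have l2 : A2 <= (1 + Q) * B2.
  have : A2 - B2 <= Q * B2 * D by apply: le_trans k2; exact: ler_norm.
  have : Q * B2 * D <= Q * B2 by rewrite ler_piMr ?mulr_ge0.
  lra.
have pos1 : 0 <= (1 + P) * B1 by rewrite mulr_ge0 // addr_ge0.
split; first by rewrite mulrACA; apply: ler_pM.
have -> : A1 * A2 - B1 * B2 = (A1 - B1) * A2 + B1 * (A2 - B2) by ring.
apply: le_trans (ler_normD _ _) _.
rewrite !normrM (ger0_norm a2) (ger0_norm b1).
apply: (@le_trans _ _ (P * B1 * D * ((1 + Q) * B2) + B1 * (Q * B2 * D))).
  by apply: lerD; [apply: ler_pM|apply: ler_wpM2l].
have : 0 <= B1 * B2 * D by rewrite !mulr_ge0.
nra.
Qed.

Lemma jacobi_weightN p q x :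
  jacobi_weight (- p) (- q) x = (jacobi_weight p q x)^-1.
Proof. by rewrite /jacobi_weight !powRN invfM. Qed.

(** The upper bound of [jacobi_weight_near], applied to the reciprocal weight. *)
Lemma jacobi_weight_near_ge p q t x : -1 < t < 1 -> `|x - t| <= half_gap t ->
  jacobi_weight p q t <= weight_cst (- p) (- q) * jacobi_weight p q x.
Proof.
move=> t1 xt; have [+ _] := jacobi_weight_near (- p) (- q) t1 xt.
have x1 := half_gap_itv t1 xt.
rewrite !jacobi_weightN ler_pdivlMr ?jacobi_weight_gt0 //.
by rewrite mulrC ler_pdivrMr ?jacobi_weight_gt0.
Qed.

Lemma jacobi_weight_decomp a b x : -1 < x < 1 ->
  jacobi_weight a b x = u_plus a b x / u_minus a b x.
Proof.
move=> x1; rewrite /u_plus /u_minus -jacobi_weightN /jacobi_weight mulrACA.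
have pn c : c = pos_part c - neg_part c.
  rewrite /pos_part /neg_part; have [h|h] := leP 0 c.
    by rewrite max_l; lra.
  by rewrite max_r; lra.
rewrite -!powRD; try by apply/implyP => _; rewrite gt_eqF //; lra.
by rewrite -!pn.
Qed.

End weights.

(** * Dyadic polynomial approximation *)

Section approximants.
Context (R : realType).

(* [geo_conv q d k] is the sum of the q ^+ (k - j) * d j over j <= k. *)
Fixpoint geo_conv (q : R) (d : nat -> R) (k : nat) : R :=
  if k is k'.+1 then q * geo_conv q d k' + d k else d 0%N.

Lemma geo_conv_ge0 q d k : 0 <= q -> (forall j, 0 <= d j) ->
  0 <= geo_conv q d k.
Proof.
by move=> q0 d0; elim: k => [|k IH] //=; rewrite addr_ge0 ?mulr_ge0.
Qed.

(** Summing the recurrence of [geo_conv] expresses the sum of d as (1 - q) times the sum of the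
    convolution plus q times its last term, which is nonnegative. *)
Lemma sum_geo_conv q d n : 0 <= q < 1 -> (forall j, 0 <= d j) ->
  \sum_(k < n) geo_conv q d k <= (\sum_(k < n) d k) / (1 - q).
Proof.
move=> /andP[q0 q1] d0; case: n => [|n]; first by rewrite !big_ord0 mul0r.
rewrite ler_pdivlMr ?subr_gt0 // mulrC.
have -> : \sum_(k < n.+1) d k =
    (1 - q) * (\sum_(k < n.+1) geo_conv q d k) + q * geo_conv q d n.
  elim: n => [|n IH]; first by rewrite !big_ord1 /=; ring.
  by rewrite big_ord_recr IH [in RHS]big_ord_recr /=; ring.
by rewrite lerDl mulr_ge0 // geo_conv_ge0.
Qed.

(** All that the Hilbert transform estimates use of the approximability of g: weighted errors e_k at
    degree 2^k with partial sums at most S, and a weighted bound M. Only interior points occur,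
    which avoids the endpoint conventions and makes the notion stable under x -> -x. *)
Record approximants (w g : R -> R) (P : nat -> {poly R}) (e : nat -> R)
    (M S : R) : Prop := Approximants {
  apx_size : forall k, (size (P k) <= (2 ^ k).+1)%N;
  apx_err : forall k (x : R), -1 < x < 1 -> `|g x - (P k).[x]| * w x <= e k;
  apx_bound : forall x : R, -1 < x < 1 -> `|g x| * w x <= M;
  apx_ge0 : forall k, 0 <= e k;
  apx_sum : forall n, \sum_(k < n) e k <= S;
  apx_weight : forall x : R, -1 < x < 1 -> 0 < w x }.

Variables (w g : R -> R) (P : nat -> {poly R}) (e : nat -> R) (M S : R).
Hypothesis apx : approximants w g P e M S.

(** Bounds the weighted size of the [layer]s, the telescoping differences of the P_k; layer 0 is P_0
    itself, so M replaces the missing previous error. *)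
Definition diff_bound (M : R) (e : nat -> R) (k : nat) : R :=
  if k is k'.+1 then e k' + e k else M + e 0%N.

Lemma approximants_M_ge0 : 0 <= M.
Proof.
have I0 : -1 < (0 : R) < 1 by lra.
by apply: le_trans (apx_bound apx I0); rewrite mulr_ge0 // ltW // (apx_weight apx).
Qed.

Lemma approximants_S_ge0 : 0 <= S.
Proof. by have := apx_sum apx 0; rewrite big_ord0. Qed.

Lemma diff_bound_ge0 k : 0 <= diff_bound M e k.
Proof.
case: k => [|k] /=; rewrite addr_ge0 // ?(apx_ge0 apx) //.
exact: approximants_M_ge0.
Qed.

Lemma sum_diff_bound n : \sum_(k < n) diff_bound M e k <= M + 2 * S.
Proof.
have M0 := approximants_M_ge0; have S0 := approximants_S_ge0.
case: n => [|n]; first by rewrite big_ord0; lra.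
have := apx_sum apx n; have := apx_sum apx n.+1.
rewrite !big_ord_recl /=.
have -> : \sum_(i < n) diff_bound M e (lift ord0 i) =
    \sum_(i < n) e i + \sum_(i < n) e (lift ord0 i).
  by rewrite -big_split.
lra.
Qed.

Definition layer (k : nat) : {poly R} :=
  if k is k'.+1 then P k - P k' else P 0%N.

Lemma size_layer k : (size (layer k) <= (2 ^ k).+1)%N.
Proof.
case: k => [|k]; first exact: (apx_size apx).
rewrite (leq_trans (size_polyD _ _)) // geq_max size_polyN (apx_size apx) /=.
by rewrite (leq_trans (apx_size apx _)) // ltnS leq_exp2l.
Qed.

Lemma layer_le k x : -1 < x < 1 -> `|(layer k).[x]| * w x <= diff_bound M e k.
Proof.
move=> x1; have w0 := ltW (apx_weight apx x1).
case: k => [|k] /=.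
  have := apx_err apx 0 x1; have := apx_bound apx x1.
  have : `|(P 0%N).[x]| <= `|g x| + `|g x - (P 0%N).[x]|.
    by rewrite -{1}(subKr (g x) (P 0%N).[x]) ler_normB.
  move=> /(ler_wpM2r w0); lra.
have := apx_err apx k x1; have := apx_err apx k.+1 x1.
have : `|(P k.+1 - P k).[x]| <= `|g x - (P k).[x]| + `|g x - (P k.+1).[x]|.
  rewrite hornerD hornerN (_ : _ - _ = (g x - (P k).[x]) - (g x - (P k.+1).[x])).
    exact: ler_normB.
  by ring.
move=> /(ler_wpM2r w0); lra.
Qed.

(** P_k is the sum of its layers j <= k. Layer j has degree at most 2^j, so Markov's inequality
    costs 4^j, and the sum of 4^j d_j over j <= k is 4^k times the convolution of ratio 1/4. *)
Lemma approximants_lipschitz (c d w0 : R) k x y : -1 < c -> c < d -> d < 1 ->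
  0 < w0 -> (forall z, c <= z <= d -> w0 <= w z) ->
  c <= x <= d -> c <= y <= d ->
  `|(P k).[x] - (P k).[y]| <=
    8 / w0 / (d - c) * `|x - y| * 4 ^+ k * geo_conv (4^-1) (diff_bound M e) k.
Proof.
move=> c1 cd d1 w00 hw xcd ycd.
have lay j : `|(layer j).[x] - (layer j).[y]| <=
    8 / w0 / (d - c) * `|x - y| * 4 ^+ j * diff_bound M e j.
  have bl z : c <= z <= d -> `|(layer j).[z]| <= diff_bound M e j / w0.
    move=> zcd; have z1 : -1 < z < 1 by lra.
    rewrite ler_pdivlMr //; apply: le_trans (layer_le j z1).
    by rewrite ler_wpM2l ?hw.
  apply: le_trans (poly_lipschitz (size_layer j) cd bl xcd ycd) _.
  rewrite -natrX -expnM mulnC expnM natrX.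
  rewrite (_ : (2 ^ 2)%N%:R = 4 :> R) // le_eqVlt; apply/orP; left; apply/eqP.
  by ring.
elim: k => [|k IH] /=; first exact: (lay 0%N).
have -> : (P k.+1).[x] - (P k.+1).[y] = ((layer k.+1).[x] - (layer k.+1).[y]) +
    ((P k).[x] - (P k).[y]) by rewrite /= !hornerD !hornerN; ring.
apply: le_trans (ler_normD _ _) _.
apply: le_trans (lerD (lay k.+1) IH) _.
rewrite le_eqVlt; apply/orP; left; apply/eqP; rewrite exprS /=.
by field; rewrite gt_eqF ?subr_gt0 // gt_eqF.
Qed.

End approximants.

(** * Integrability *)

Section integration.
Context (R : realType).
Notation mu := (@lebesgue_measure R).

Lemma Rintegral_FTC (f F : R -> R) (a b : R) : a < b ->
  (forall x, a <= x <= b -> is_derive x 1 F (f x)) ->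
  (forall x, a <= x <= b -> {for x, continuous f}) ->
  mu.-integrable `[a, b] (EFin \o f) /\
  \int[mu]_(x in `[a, b]) f x = F b - F a.
Proof.
move=> ab dF cf.
have cfw : {within `[a, b], continuous f}.
  by apply: continuous_in_subspaceT => x /set_mem /=; rewrite in_itv; exact: cf.
have cF x : a <= x <= b -> {for x, continuous F}.
  move=> /dF H; apply: differentiable_continuous; apply/derivable1_diffP.
  exact: ex_derive.
split.
  by apply: continuous_compact_integrable => //; exact: segment_compact.
rewrite /Rintegral (@continuous_FTC2 _ f F) // ?EFinB //.
  split.
  - move=> x; rewrite in_itv /= => /andP[ax xb].
    by have H : is_derive x 1 F (f x); [apply: dF; rewrite !ltW|exact: ex_derive].
  - by apply: cvg_at_right_filter; apply: cF; rewrite lexx ltW.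
  - by apply: cvg_at_left_filter; apply: cF; rewrite lexx ltW.
move=> x; rewrite in_itv /= => /andP[ax xb]; rewrite derive1E.
by have H : is_derive x 1 F (f x); [apply: dF; rewrite !ltW|exact: derive_val].
Qed.

Lemma ge0_integral_reflect (D : set R) (f : R -> \bar R) :
  measurable D -> measurable_fun D f -> (forall x, D x -> 0 <= f x)%E ->
  (\int[mu]_(x in D) f x = \int[mu]_(x in -%R @^-1` D) f (- x)%R)%E.
Proof.
move=> mD mf f0.
transitivity (\int[pushforward mu (-%R : _ -> measurableTypeR R)]_(x in D) f x)%E.
  by apply: eq_measure_integral => //= A mA _; exact/esym/lebesgue_measureN.
rewrite ge0_integral_pushforward //.
by move=> y /set_mem; exact: f0.
Qed.

Lemma sum_geometric_le (r : R) n : 0 <= r < 1 ->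
  \sum_(k < n) r ^+ k <= (1 - r)^-1.
Proof.
move=> /andP[r0 r1]; rewrite -[leRHS]mul1r ler_pdivlMr ?subr_gt0 //.
have := subrX1 r n; have : 0 <= r ^+ n by rewrite exprn_ge0.
by lra.
Qed.

Lemma powR_exprn (x p : R) k : 0 <= x -> (x ^+ k) `^ p = (x `^ p) ^+ k.
Proof.
move=> x0; elim: k => [|k IH]; first by rewrite !expr0 powR1.
by rewrite !exprS powRM ?exprn_ge0 // IH.
Qed.

Lemma half_powR_lt1 (p : R) : 0 < p -> 0 <= 2^-1 `^ p < (1 : R).
Proof.
move=> p0; rewrite powR_ge0 /=.
have : 2^-1 `^ p < (1 : R) `^ p by apply: gt0_ltr_powR; rewrite ?nnegrE //; lra.
by rewrite powR1.
Qed.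

Lemma measurable_normB_le (c h : R) : measurable [set x | 0 < `|x - c| <= h].
Proof.
rewrite (_ : [set _ | _] = [set x | `|x - c| \in `]0, h]]).
  exact: measurable_normB_itv.
by apply/seteqP; split => x /=; rewrite in_itv.
Qed.

(** On the annuli of ratio 1/2, |x - c|^(p+1) is at most h^(p+1) r^k with r = 2^-(p+1) < 1: the
    dyadic bounds are geometric exactly because p > -1. *)
Lemma integral_powR_norm (A : set R) (K : R -> R) (c h p M : R) :
  -1 < p -> 0 < h -> 0 <= M -> measurable A -> measurable_fun A K ->
  (forall x, A x -> 0 < `|x - c| <= h) ->
  (forall x, A x -> `|K x| <= M * `|x - c| `^ p) ->
  mu.-integrable A (EFin \o K) /\
  \int[mu]_(x in A) `|K x| <=
    4 * (M * h `^ (p + 1) / (1 - 2^-1 `^ (p + 1))).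
Proof.
move=> p1 h0 M0 mA mK Ah AK; set r := 2^-1 `^ (p + 1).
have r01 : 0 <= r < 1 by apply: half_powR_lt1; lra.
have -> : 4 = 2 / 2^-1 :> R by rewrite invrK -natrM.
apply: (@dyadic_integrable R A K c h 2^-1 _
  (fun k => M * h `^ (p + 1) * r ^+ k)) => //; first lra.
- move=> k x Ax /andP[_ xk]; have /andP[x0 _] := Ah x Ax.
  apply: le_trans (AK x Ax) _; rewrite ler_pdivlMr // -mulrA -mulrA.
  apply: ler_wpM2l => //.
  have -> : `|x - c| `^ p * `|x - c| = `|x - c| `^ (p + 1).
    by rewrite powRD ?powRr1 //; apply/implyP => _; rewrite gt_eqF.
  rewrite /r -powR_exprn // -powRM ?exprn_ge0 //; last exact: ltW.
  have hk : 0 <= h * 2^-1 ^+ k by rewrite mulr_ge0 ?exprn_ge0 // ltW.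
  by apply: ge0_ler_powR; rewrite ?nnegrE //; lra.
- by move=> k; rewrite mulr_ge0 ?exprn_ge0 // ?mulr_ge0 ?powR_ge0 //; case/andP: r01.
- by move=> n; rewrite -mulr_sumr ler_wpM2l ?mulr_ge0 ?powR_ge0 ?sum_geometric_le.
Qed.

(** The identity y^-1 = y |y|^-2, valid also at 0 where both sides vanish, reduces the claim to real
    powers. *)
Lemma measurable_invr : measurable_fun setT (@GRing.inv R).
Proof.
rewrite (_ : @GRing.inv R = fun y => y * (`|y| `^ (- 2%:R))); last first.
  apply/funext => y; rewrite powR_invn // -normrX ger0_norm ?sqr_ge0 //.
  have [->|y0] := eqVneq y 0; first by rewrite mul0r invr0.
  by field.
apply: measurable_funM; first exact: measurable_id.
apply: (measurableT_comp (measurable_powR _)).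
exact: normr_measurable.
Qed.

Lemma measurable_jacobi_weight (p q : R) D :
  measurable_fun D (jacobi_weight p q).
Proof.
apply: measurable_funTS; rewrite /jacobi_weight.
apply: measurable_funM.
  apply: (measurableT_comp (measurable_powR _)).
  by apply: measurable_funB.
apply: (measurableT_comp (measurable_powR _)).
exact: measurable_funD.
Qed.

Lemma powR_le_cst (y q : R) : 1 <= y <= 2 -> y `^ q <= 2 `^ `|q|.
Proof.
move=> /andP[y1 y2]; apply: (@le_trans _ _ (y `^ `|q|)).
  by apply: ler_powR => //; exact: ler_norm.
by apply: ge0_ler_powR; rewrite ?nnegrE //; lra.
Qed.

Lemma integrable_setU (A B : set R) (f : R -> R) :
  measurable A -> measurable B -> [disjoint A & B] ->
  mu.-integrable A (EFin \o f) -> mu.-integrable B (EFin \o f) ->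
  mu.-integrable (A `|` B) (EFin \o f).
Proof.
move=> mA mB AB /integrableP[mfA iA] /integrableP[mfB iB].
have mf : measurable_fun (A `|` B) (EFin \o f) by apply/measurable_funU.
apply/integrableP; split => //; rewrite ge0_integral_setU //.
  by rewrite lte_add_pinfty.
exact: measurableT_comp.
Qed.

Lemma integrable_jacobi_weight (p q : R) : -1 < p -> -1 < q ->
  mu.-integrable `]-1, 1[ (EFin \o jacobi_weight p q).
Proof.
move=> p1 q1; rewrite (@itv_bndbnd_setU _ _ _ (BLeft (0 : R))) ?bnd_simp //;
  try lra.
apply: integrable_setU; rewrite //=.
  apply/disj_setPS => x [] /=; rewrite !in_itv /=; lra.
  have [] := @integral_powR_norm `]-1, 0[ (jacobi_weight p q) (-1) 1 q
    (2 `^ `|p|) q1 _ (powR_ge0 _ _) _ (@measurable_jacobi_weight _ _ _) _ _ => //.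
    by move=> x /=; rewrite in_itv /= => ?; rewrite ger0_norm; lra.
  move=> x /=; rewrite in_itv /= => ?.
  have -> : `|x - -1| = 1 + x by rewrite ger0_norm; lra.
  rewrite ger0_norm ?jacobi_weight_ge0 //.
  by apply: ler_wpM2r; rewrite ?powR_ge0 // powR_le_cst //; lra.
have [] := @integral_powR_norm `[0, 1[ (jacobi_weight p q) 1 1 p
    (2 `^ `|q|) p1 _ (powR_ge0 _ _) _ (@measurable_jacobi_weight _ _ _) _ _ => //.
  by move=> x /=; rewrite in_itv /= => ?; rewrite distrC ger0_norm; lra.
move=> x /=; rewrite in_itv /= => ?.
have -> : `|x - 1| = 1 - x by rewrite distrC ger0_norm; lra.
rewrite ger0_norm ?jacobi_weight_ge0 //.
rewrite /jacobi_weight mulrC; apply: ler_wpM2r; rewrite ?powR_ge0 //.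
by rewrite powR_le_cst //; lra.
Qed.

End integration.

(** * The principal value *)

Definition hilbert_kernel (R : realType) (a b : R) (g : R -> R) (t x : R) : R :=
  g x / (x - t) * jacobi_weight a b x.

Section principal_value.
Context (R : realType).
Notation mu := (@lebesgue_measure R).
Variables (a b : R) (ha : -1 < a) (hb : -1 < b).
Variables (g : R -> R) (P : nat -> {poly R}) (e : nat -> R) (M S : R).
Hypothesis apx : approximants (u_plus a b) g P e M S.
Hypothesis cg : {in `](-1 : R), 1[, continuous g}.

Let F x := g x * jacobi_weight a b x.

Lemma continuous_oo_measurable (f : R -> R) (c d : R) :
  {in `]c, d[, continuous f} -> measurable_fun `]c, d[ f.
Proof.
move=> cf; apply: subspace_continuous_measurable_fun => //.
by apply: continuous_in_subspaceT => x /set_mem /=; exact: cf.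
Qed.

Lemma measurable_weighted : measurable_fun `](-1 : R), 1[ F.
Proof.
apply: measurable_funM; first exact: continuous_oo_measurable.
exact: measurable_jacobi_weight.
Qed.

Lemma neg_part_lt1 (c : R) : -1 < c -> -1 < - neg_part c.
Proof. by rewrite /neg_part; case: (leP 0 (- c)) => _ ?; lra. Qed.

Lemma normr_weighted x : -1 < x < 1 ->
  `|F x| = `|g x| * u_plus a b x / u_minus a b x.
Proof.
move=> x1; rewrite /F normrM (ger0_norm (jacobi_weight_ge0 _ _ _)).
by rewrite jacobi_weight_decomp // mulrA.
Qed.

Lemma normr_weighted_le x : -1 < x < 1 -> `|F x| <= M / u_minus a b x.
Proof.
move=> x1; rewrite normr_weighted //; apply: ler_wpM2r.
  by rewrite invr_ge0 jacobi_weight_ge0.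
exact: (apx_bound apx).
Qed.

(** F is dominated by M / u_minus, a Jacobi weight whose exponents are still greater than -1. *)
Lemma integrable_weighted : mu.-integrable `]-1, 1[ (EFin \o F).
Proof.
have wi := integrable_jacobi_weight (neg_part_lt1 ha) (neg_part_lt1 hb).
have : mu.-integrable `]-1, 1[
    (fun x => M%:E * (jacobi_weight (- neg_part a) (- neg_part b) x)%:E)%E.
  exact: integrableZl.
apply: le_integrable => //.
  by apply/measurable_EFinP; exact: measurable_weighted.
move=> x /=; rewrite in_itv /= => x1; rewrite lee_fin.
rewrite [leRHS]ger0_norm; last first.
  by rewrite mulr_ge0 ?jacobi_weight_ge0 // (approximants_M_ge0 apx).
by rewrite jacobi_weightN; exact: normr_weighted_le.
Qed.

Local Notation kern := (hilbert_kernel a b g).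

Lemma integrable_kernel (t d : R) (A : set R) : 0 < d -> measurable A ->
  A `<=` `](-1 : R), 1[ -> (forall x, A x -> d <= `|x - t|) ->
  mu.-integrable A (EFin \o kern t).
Proof.
move=> d0 mA A1 Ad.
have iA : mu.-integrable A (EFin \o F).
  by apply: integrableS integrable_weighted.
have : mu.-integrable A (fun x => d^-1%:E * (F x)%:E)%E.
  exact: integrableZl.
have mK : measurable_fun A (fun x => F x * (x - t)^-1).
  apply: measurable_funM.
    exact: measurable_funS measurable_weighted.
  apply: measurable_funTS; apply: (measurableT_comp (@measurable_invr R)).
  exact: measurable_funB.
apply: le_integrable => //.
  apply/measurable_EFinP; move: mK; congr measurable_fun.
  by apply/funext => x; rewrite /F /hilbert_kernel mulrAC.
move=> x Ax /=; rewrite lee_fin /hilbert_kernel mulrAC -/(F x) !normrM.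
rewrite mulrC; apply: ler_wpM2r => //.
rewrite !normfV (gtr0_norm d0) lef_pV2 ?posrE //; first exact: Ad.
by rewrite (lt_le_trans d0) // Ad.
Qed.

Let near_cst := weight_cst a b * weight_cst (- pos_part a) (- pos_part b).

(** With u the Jacobi weight, F x - F t = (g x - g t) u x + g t (u x - u t). In the first term,
    replacing g by P_k costs e_k at x and at t, and the Lipschitz factor 4^k on [t - h, t + h] is
    cancelled by |x - t| <= h 4^-k. In the second, the relative variation of u is of order 4^-k. *)
Lemma near_diff_le t x k : -1 < t < 1 ->
  `|x - t| <= half_gap t * 4^-1 ^+ k ->
  `|F x - F t| <= near_cst / u_minus a b t *
    (2 * e k + 4 * geo_conv 4^-1 (diff_bound M e) k + M * 4^-1 ^+ k).
Proof.
move=> t1 xtk; have h0 := half_gap_gt0 t1; have [h1 h2] := half_gapP t.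
have q0 : 0 < 4^-1 ^+ k :> R by apply: exprn_gt0; lra.
have q1 : 4^-1 ^+ k <= 1 :> R by apply: exprn_ile1; lra.
have xt : `|x - t| <= half_gap t.
  by apply: le_trans xtk _; rewrite ger_pMr.
have x1 := half_gap_itv t1 xt.
set h := half_gap t in h0 h1 h2 xtk xt *.
set s := geo_conv _ _ _.
have up0 : 0 < u_plus a b t by exact: jacobi_weight_gt0.
have um0 : 0 < u_minus a b t by exact: jacobi_weight_gt0.
set C3 := weight_cst (- pos_part a) (- pos_part b).
have C31 : 1 <= C3 by exact: weight_cst_ge1.
have M0 := approximants_M_ge0 apx.
have e0 := apx_ge0 apx k.
have s0 : 0 <= s by apply: geo_conv_ge0 => // j; exact: (diff_bound_ge0 apx).
pose w0 := u_plus a b t / C3.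
have w00 : 0 < w0 by rewrite divr_gt0 //; lra.
have hw z : `|z - t| <= h -> w0 <= u_plus a b z.
  move=> zt; rewrite ler_pdivrMr; last lra.
  by rewrite mulrC; exact: jacobi_weight_near_ge.
have gx : `|g x - g t| * w0 <= 2 * e k + 4 * s.
  have -> : g x - g t = (g x - (P k).[x]) + ((P k).[x] - (P k).[t])
      - (g t - (P k).[t]) by ring.
  apply: (@le_trans _ _ (`|g x - (P k).[x]| * w0 +
      `|(P k).[x] - (P k).[t]| * w0 + `|g t - (P k).[t]| * w0)).
    rewrite -!mulrDl; apply: ler_wpM2r; first exact: ltW.
    by apply: le_trans (ler_normB _ _) _; rewrite lerD2r ler_normD.
  have E1 z : `|z - t| <= h -> `|g z - (P k).[z]| * w0 <= e k.
    move=> zt; apply: le_trans (apx_err apx k (half_gap_itv t1 zt)).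
    by apply: ler_wpM2l => //; exact: hw.
  have E2 : `|(P k).[x] - (P k).[t]| * w0 <= 4 * s.
    rewrite -ler_pdivlMr //.
    have hz z : t - h <= z <= t + h -> `|z - t| <= h.
      by rewrite ler_distl.
    apply: le_trans (@approximants_lipschitz R _ g P e M S apx (t - h) (t + h)
      w0 k x t _ _ _ w00 _ _ _) _; rewrite -/s; try lra.
    - by move=> z /hz; exact: hw.
    - by rewrite -ler_distl.
    - have -> : t + h - (t - h) = 2 * h by ring.
      have -> : 4 * s / w0 = 8 / w0 / (2 * h) * (h * 4^-1 ^+ k) * 4 ^+ k * s.
        rewrite exprVn; field.
        by rewrite !gt_eqF // exprn_gt0.
      apply: ler_wpM2r => //; apply: ler_wpM2r; first by rewrite exprn_ge0.
      by apply: ler_wpM2l => //; rewrite !mulr_ge0 ?invr_ge0 ?ltW //; lra.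
  have := E1 x xt; have := E1 t; rewrite subrr normr0 => /(_ (ltW h0)).
  lra.
have [U1 U2] := jacobi_weight_near a b t1 xt.
have C11 := weight_cst_ge1 a b.
have ut : jacobi_weight a b t = u_plus a b t / u_minus a b t.
  exact: jacobi_weight_decomp.
have gt : `|g t| * u_plus a b t <= M by exact: (apx_bound apx).
have -> : F x - F t = (g x - g t) * jacobi_weight a b x +
   g t * (jacobi_weight a b x - jacobi_weight a b t) by rewrite /F; ring.
apply: le_trans (ler_normD _ _) _.
rewrite (normrM (g x - g t)) (normrM (g t)).
rewrite (ger0_norm (jacobi_weight_ge0 _ _ _)) mulrDr; apply: lerD.
  apply: (@le_trans _ _ (`|g x - g t| * (weight_cst a b * jacobi_weight a b t))).
    exact: ler_wpM2l.
  rewrite ut /near_cst -/C3.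
  have -> : `|g x - g t| * (weight_cst a b * (u_plus a b t / u_minus a b t)) =
     weight_cst a b * C3 / u_minus a b t * (`|g x - g t| * w0).
    by rewrite /w0; field; rewrite !gt_eqF //; lra.
  apply: ler_wpM2l => //.
  by apply: divr_ge0; [apply: mulr_ge0; lra|exact: ltW].
apply: (@le_trans _ _ (`|g t| * (weight_cst a b * jacobi_weight a b t *
    4^-1 ^+ k))).
  apply: ler_wpM2l => //; apply: le_trans U2 _.
  apply: ler_wpM2l; first by rewrite mulr_ge0 ?jacobi_weight_ge0 //; lra.
  by rewrite ler_pdivrMr // mulrC.
rewrite ut /near_cst -/C3.
have -> : `|g t| * (weight_cst a b * (u_plus a b t / u_minus a b t) * 4^-1 ^+ k)
  = (`|g t| * u_plus a b t) * (weight_cst a b * 1 / u_minus a b t * 4^-1 ^+ k).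
  by ring.
have -> : weight_cst a b * C3 / u_minus a b t * (M * 4^-1 ^+ k) =
  M * (weight_cst a b * C3 / u_minus a b t * 4^-1 ^+ k) by ring.
have n0 : 0 <= (u_minus a b t)^-1 by rewrite invr_ge0 ltW.
apply: ler_pM => //.
- by rewrite mulr_ge0 // ltW.
- by rewrite mulr_ge0 ?(ltW q0) // mulr_ge0 //; lra.
- apply: ler_wpM2r; first exact: ltW.
  by apply: ler_wpM2r => //; apply: ler_wpM2l => //; lra.
Qed.

Let dkern t x := (F x - F t) / (x - t).

Lemma near_integrable t : -1 < t < 1 ->
  mu.-integrable [set x | 0 < `|x - t| <= half_gap t] (EFin \o dkern t) /\
  \int[mu]_(x in [set x | 0 < `|x - t| <= half_gap t]) `|dkern t x| <=
    104 * near_cst * (M + S) / u_minus a b t.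
Proof.
move=> t1; have h0 := half_gap_gt0 t1.
have um0 : 0 < u_minus a b t by exact: jacobi_weight_gt0.
have M0 := approximants_M_ge0 apx; have S0 := approximants_S_ge0 apx.
have nc0 : 0 <= near_cst.
  rewrite /near_cst; have := weight_cst_ge1 a b.
  have := weight_cst_ge1 (- pos_part a) (- pos_part b).
  by move=> ? ?; rewrite mulr_ge0 //; lra.
have c0 : 0 <= near_cst / u_minus a b t by rewrite divr_ge0 // ltW.
(* Here 2 / q = 8 for q = 1/4, and 2 S + 4 (4/3) (M + 2 S) + (4/3) M <= 13 (M + S). *)
have -> : 104 * near_cst * (M + S) / u_minus a b t =
  2 / 4^-1 * (near_cst / u_minus a b t * (13 * (M + S))).
  by field; rewrite gt_eqF.
set s := geo_conv 4^-1 (diff_bound M e).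
apply: (@dyadic_integrable R _ (dkern t) t (half_gap t) 4^-1 _
  (fun k => near_cst / u_minus a b t * (2 * e k + 4 * s k + M * 4^-1 ^+ k))) => //.
- exact: measurable_normB_le.
- apply: measurable_funM.
    apply: measurable_funB => //.
    apply: measurable_funS measurable_weighted => //.
    by move=> x /= /andP[_ /(half_gap_itv t1)]; rewrite in_itv.
  apply: measurable_funTS; apply: (measurableT_comp (@measurable_invr R)).
  exact: measurable_funB.
- lra.
- move=> k x /= /andP[x0 _] /andP[_ xk].
  rewrite /dkern normrM normfV; apply: ler_wpM2r; first by rewrite invr_ge0.
  exact: near_diff_le.
- move=> k; apply: mulr_ge0 => //.
  have s0 : 0 <= s k by apply: geo_conv_ge0 => // j; exact: (diff_bound_ge0 apx).
  by rewrite !addr_ge0 ?mulr_ge0 ?(apx_ge0 apx) ?exprn_ge0.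
- move=> n; rewrite -mulr_sumr; apply: ler_wpM2l => //.
  rewrite !big_split /= -!mulr_sumr.
  have := apx_sum apx n; have := @sum_geometric_le R 4^-1 n.
  have := @sum_geo_conv R 4^-1 (diff_bound M e) n _ (diff_bound_ge0 apx).
  have := sum_diff_bound apx n; rewrite -/s.
  move: (\sum_(k < n) diff_bound M e k) (\sum_(k < n) e k) => D E.
  move: (\sum_(k < n) s k) (\sum_(k < n) 4^-1 ^+ k) => X Y h1 h2 h3 h4.
  have {}h2 : X <= D / (1 - 4^-1) by apply: h2; lra.
  have {}h3 : Y <= (1 - 4^-1)^-1 by apply: h3; lra.
  have i34 : (1 - 4^-1)^-1 = 4 / 3 :> R by field.
  rewrite i34 in h2 h3.
  have : M * Y <= M * (4 / 3) by apply: ler_wpM2l.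
  lra.
Qed.

(** The odd kernel has opposite logarithmic integrals on the two sides of t. This is the
    cancellation that allows F t to be subtracted inside the principal value. *)
Lemma Rintegral_inv_annulus (t d h : R) : 0 < d < h ->
  mu.-integrable [set x | d <= `|x - t| <= h] (EFin \o (fun x => (x - t)^-1)) /\
  \int[mu]_(x in [set x | d <= `|x - t| <= h]) (x - t)^-1 = 0.
Proof.
move=> /andP[d0 dh].
have [r1 r2] : mu.-integrable `[t + d, t + h] (EFin \o (fun x => (x - t)^-1)) /\
    \int[mu]_(x in `[t + d, t + h]) (x - t)^-1 = ln h - ln d.
  have -> : ln h - ln d = ln (t + h - t) - ln (t + d - t) by congr (ln _ - ln _); ring.
  apply: (@Rintegral_FTC R _ (fun x => ln (x - t))); first lra.
    move=> x xI; have x0 : 0 < x - t by lra.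
    have := @is_derive1_comp R (@ln R) (fun x => x - t) x (x - t)^-1 1.
    rewrite mulr1; apply; first exact: is_derive1_ln.
    by apply: is_derive_eq; rewrite subr0.
  move=> x xI; apply: continuousV; first by rewrite gt_eqF //; lra.
  by apply: continuousB; [exact: cvg_id|exact: cvg_cst].
have [l1 l2] : mu.-integrable `[t - h, t - d] (EFin \o (fun x => (x - t)^-1)) /\
    \int[mu]_(x in `[t - h, t - d]) (x - t)^-1 = ln d - ln h.
  have -> : ln d - ln h = ln (t - (t - d)) - ln (t - (t - h)).
    by congr (ln _ - ln _); ring.
  apply: (@Rintegral_FTC R _ (fun x => ln (t - x))); first lra.
    move=> x xI; have x0 : 0 < t - x by lra.
    have := @is_derive1_comp R (@ln R) (fun x => t - x) x (t - x)^-1 (-1).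
    rewrite mulrN1 -invrN opprB; apply; first exact: is_derive1_ln.
    by apply: is_derive_eq; ring.
  move=> x xI; apply: continuousV; first by rewrite lt_eqF //; lra.
  by apply: continuousB; [exact: cvg_id|exact: cvg_cst].
have AE : [set x | d <= `|x - t| <= h] = `[t - h, t - d] `|` `[t + d, t + h].
  apply/seteqP; split => x /=; rewrite !in_itv /=.
    move=> /andP[]; rewrite ler_normr ler_norml => /orP[?|?] ?; [right|left]; lra.
  case=> ?.
    by rewrite ler0_norm; lra.
  by rewrite ger0_norm; lra.
have dj : [disjoint `[t - h, t - d]%classic & `[t + d, t + h]%classic].
  by apply/disj_setPS => x [] /=; rewrite !in_itv /=; lra.
have iU : mu.-integrable (`[t - h, t - d] `|` `[t + d, t + h])
    (EFin \o (fun x => (x - t)^-1)) by apply: integrable_setU.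
by rewrite AE; split => //; rewrite Rintegral_setU // l2 r2; ring.
Qed.

Lemma measurable_kernel t : measurable_fun `](-1 : R), 1[ (kern t).
Proof.
have mK : measurable_fun `](-1 : R), 1[ (fun x => F x * (x - t)^-1).
  apply: measurable_funM; first exact: measurable_weighted.
  apply: measurable_funTS; apply: (measurableT_comp (@measurable_invr R)).
  exact: measurable_funB.
move: mK; congr measurable_fun.
by apply/funext => x; rewrite /F /hilbert_kernel mulrAC.
Qed.

(** The two endpoints, where the weight has only conventional values, form a null set. *)
Lemma Rintegral_kernel_oo t d :
  \int[mu]_(x in [set x | x \in `[(-1 : R), 1] /\ d <= `|x - t|]) kern t x =
  \int[mu]_(x in [set x | -1 < x < 1 /\ d <= `|x - t|]) kern t x.
Proof.
set D := [set x | x \in _ /\ _].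
have mD : measurable D.
  rewrite (_ : D = `[-1, 1] `&` [set x | `|x - t| \in `[d, +oo[]).
    by apply: measurableI => //; exact: measurable_normB_itv.
  by apply/seteqP; split => x /=; rewrite !in_itv /= andbT.
have mf : measurable_fun D (EFin \o kern t).
  apply/measurable_EFinP.
  apply: (@measurable_funS _ _ _ _ `[(-1 : R), 1]) => //; first by move=> x [].
  exact: measurable_fun_itv_cc (measurable_kernel t).
have -> : [set x | -1 < x < 1 /\ d <= `|x - t|] = D `\ 1 `\ -1.
  rewrite /D; apply/seteqP; split => x /=; rewrite in_itv /=.
    move=> [x1 xd]; split; last by apply/eqP; rewrite gt_eqF; lra.
    split; last by apply/eqP; rewrite lt_eqF; lra.
    by split => //; lra.
  move=> [[[x1 xd] /eqP n1] /eqP n2]; split => //.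
  by rewrite !lt_neqAle n1 eq_sym n2.
have m1 : measurable (D `\ 1) by exact: measurableD.
have m2 : measurable (D `\ 1 `\ -1) by exact: measurableD.
rewrite /Rintegral integral_setD1 //; last first.
  by apply: measurable_funS mf => // x [[]].
by rewrite integral_setD1 //; apply: measurable_funS mf => // x [].
Qed.

Definition far t : set R := [set x | -1 < x < 1 /\ half_gap t < `|x - t|].

Lemma measurable_far t : measurable (far t).
Proof.
rewrite (_ : far t = `]-1, 1[ `&` [set x | `|x - t| \in `]half_gap t, +oo[]).
  by apply: measurableI => //; exact: measurable_normB_itv.
by apply/seteqP; split => x /= []; rewrite !in_itv /= andbT.
Qed.

(** For eps < h the truncated integral is the far part plus the annulus eps <= |x - t| <= h, on
    which the kernel may be replaced by [dkern] since F t / (x - t) integrates to 0. As [dkern] is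
    integrable up to t, only the integral over 0 < |x - t| < eps is missing. *)
Lemma cvg_principal_value t : -1 < t < 1 ->
  (\int[mu]_(x in [set x | x \in `[(-1 : R), 1] /\ eps <= `|x - t|]) kern t x)
    @[eps --> 0^'+] -->
  \int[mu]_(x in far t) kern t x +
  \int[mu]_(x in [set x | 0 < `|x - t| <= half_gap t]) dkern t x.
Proof.
move=> t1; have h0 := half_gap_gt0 t1; have [iN _] := near_integrable t1.
set N := [set x | 0 < `|x - t| <= half_gap t] in iN *.
have mN : measurable N by exact: measurable_normB_le.
have iNT : mu.-integrable setT (EFin \o (dkern t \_ N)).
  by rewrite -restrict_EFin; apply/integrable_restrict => //; rewrite setTI.
apply/cvgrPdist_le => /= z z0.
(* Absolute continuity of the integral: sets of measure below d contribute less than z. The missing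
   set lies in an interval of length 2 eps, hence the later choice eps < d / 4. *)
have [d [d0 dP]] := integral_normr_continuous iNT z0.
near=> eps.
have e0 : 0 < eps by [].
have eh : eps < half_gap t by near: eps; exact: nbhs_right_lt.
have ed : eps < d / 4 by near: eps; apply: nbhs_right_lt; rewrite divr_gt0.
pose A := [set x | eps <= `|x - t| <= half_gap t].
pose B := [set x | `|x - t| \in `]0, eps[].
have mA : measurable A.
  rewrite (_ : A = [set x | `|x - t| \in `[eps, half_gap t]]).
    exact: measurable_normB_itv.
  by apply/seteqP; split => x /=; rewrite in_itv.
have mB : measurable B by exact: measurable_normB_itv.
have AN : A `<=` N.
  by move=> x /= /andP[x1 x2]; apply/andP; split => //; exact: lt_le_trans x1.
have A1 : A `<=` `](-1 : R), 1[.
  by move=> x /AN /andP[_ /(half_gap_itv t1)] /=; rewrite in_itv.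
have NE : N = B `|` A.
  apply/seteqP; split => x; last first.
    case=> [|/AN //]; rewrite /B /= in_itv /= => /andP[x0 xe].
    by apply/andP; split => //; rewrite ltW // (lt_trans xe).
  move=> /= /andP[x0 xh]; have [h|h] := ltP `|x - t| eps.
    by left; rewrite /B /= in_itv /= x0.
  by right; rewrite /A /= h.
have BA : [disjoint B & A].
  apply/disj_setPS => x []; rewrite /B /= in_itv /= => /andP[_ h1] /andP[h2 _].
  by move: h1; rewrite ltNge h2.
have iA : mu.-integrable A (EFin \o dkern t) by exact: integrableS iN.
have FA : [disjoint far t & A].
  apply/disj_setPS => x [] /= [_ h1] /andP[_ h2].
  by move: h1; rewrite ltNge h2.
have DE : [set x | -1 < x < 1 /\ eps <= `|x - t|] = far t `|` A.
  apply/seteqP; split => x /=.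
    move=> [x1 xe]; have [h|h] := leP `|x - t| (half_gap t).
      by right; rewrite /A /= xe h.
    by left.
  case=> [[x1 h]|/[dup] /A1 /=]; first by split => //; rewrite ltW // (lt_trans eh).
  by rewrite in_itv /= => x1 /andP[].
have ik : mu.-integrable (far t `|` A) (EFin \o kern t).
  apply: (@integrable_kernel t eps) => //.
  - by apply: measurableU => //; exact: measurable_far.
  - by move=> x [[? _]|/A1 //]; rewrite /= in_itv.
  - move=> x [[_ h]|/andP[] //]; exact/ltW/(lt_trans eh).
rewrite Rintegral_kernel_oo DE Rintegral_setU //; last exact: measurable_far.
have -> : \int[mu]_(x in A) kern t x = \int[mu]_(x in A) dkern t x.
  have eh0 : 0 < eps < half_gap t by rewrite e0.
  have [iv vE] := Rintegral_inv_annulus t eh0.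
  have ivF : mu.-integrable A (EFin \o (fun x => F t * (x - t)^-1)).
    have : mu.-integrable A (fun x => (F t)%:E * ((x - t)^-1)%:E)%E.
      exact: integrableZl.
    by [].
  rewrite (_ : kern t = fun x => dkern t x + F t * (x - t)^-1); last first.
    by apply/funext => x; rewrite /hilbert_kernel /dkern /F; ring.
  by rewrite RintegralD // RintegralZl // vE mulr0 addr0.
rewrite NE Rintegral_setU //; last by rewrite -NE.
have cancel (x y y1 : R) : x + (y + y1) - (x + y1) = y by ring.
rewrite cancel {cancel}.
have BN : B `<=` N by rewrite NE => x; left.
have iB : mu.-integrable B (EFin \o dkern t) by exact: integrableS iN.
apply: (@le_trans _ _ (\int[mu]_(x in B) `|dkern t x|)).
  exact: le_normr_Rintegral.
rewrite (_ : \int[mu]_(x in B) `|dkern t x| =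
   \int[mu]_(x in B) `|(dkern t \_ N) x|).
  apply/ltW/dP => //; apply: (@le_lt_trans _ _ (mu `[t - eps, t + eps])).
    apply: le_measure; rewrite ?inE // => x /=; rewrite !in_itv /=.
    by move=> /andP[_ /ltW]; rewrite ler_distl.
  rewrite lebesgue_measure_itv /= lte_fin ifT; last lra.
  by rewrite -EFinB lte_fin; lra.
apply: eq_Rintegral => x /set_mem /BN xN.
by rewrite patchE mem_set.
Unshelve. all: by end_near. Qed.

End principal_value.

(** * Decay at an endpoint *)

Section far_from_the_singularity.
Context (R : realType).
Notation mu := (@lebesgue_measure R).

(** If t >= 0, then 1 - t < 2 |x - t|, and 1 - x follows by the triangle inequality. If t < 0, then
    |x - t| is at least -t and exceeds (1 + t) / 2, hence exceeds 1/3. The kernel is thus controlled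
    by the distances of x and t to the endpoint 1. *)
Lemma far_dist_ge (t x : R) : -1 < t < 1 -> 0 <= x < 1 ->
  half_gap t < `|x - t| -> (1 - x) + (1 - t) <= 9 * `|x - t|.
Proof.
rewrite /half_gap => t1 x1.
have [h|h] := leP 0 t; have [k|k] := leP 0 (x - t);
  by rewrite ?(ger0_norm h) ?(ltr0_norm h) ?(ger0_norm k) ?(ltr0_norm k); lra.
Qed.

(* By Markov's inequality a polynomial of degree N is, up to a factor 2,
   already maximal at distance 1 / (16 N^2) from the endpoint. *)
Lemma poly_endpoint_bound (a m : R) (N : nat) (Q : {poly R}) : 0 < a ->
  (0 < N)%N -> (size Q <= N.+1)%N ->
  (forall x, 0 <= x < 1 -> `|Q.[x]| * (1 - x) `^ a <= m) ->
  forall x, 0 <= x <= 1 -> `|Q.[x]| <= 2 * (16 * N%:R ^+ 2) `^ a * m.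
Proof.
move=> a0 N0 sQ bQ.
have cQ : {within `[(0 : R), 1], continuous (fun x => `|Q.[x]|)}.
  apply: continuous_in_subspaceT => x _; apply: continuous_comp.
    exact: continuous_horner.
  exact: norm_continuous.
have [y y01 Qy] := EVT_max ler01 cQ.
have n1 : 1 <= N%:R :> R by rewrite ler1n.
have N20 : 0 < 16 * N%:R ^+ 2 :> R by rewrite mulr_gt0 // exprn_gt0 // ltr0n.
pose d : R := (16 * N%:R ^+ 2)^-1.
have d0 : 0 < d by rewrite invr_gt0.
have d1 : d <= 16^-1.
  by rewrite lef_pV2 ?posrE // ler_peMr // exprn_ege1.
pose z := Num.min y (1 - d).
move: y01; rewrite in_itv /= => y01.
have [z01 [yz zd]] : 0 <= z <= 1 /\ `|y - z| <= d /\ z <= 1 - d.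
  rewrite /z; have [h|h] := leP y (1 - d); first by rewrite subrr normr0; lra.
  by rewrite ger0_norm; lra.
have M' x : 0 <= x <= 1 -> `|Q.[x]| <= `|Q.[y]|.
  by move=> x1; apply: Qy; rewrite in_itv.
have lip := poly_lipschitz sQ ltr01 M' y01 z01.
have Qyz : `|Q.[y]| <= 2 * `|Q.[z]|.
  have h1 : `|Q.[y]| <= `|Q.[y] - Q.[z]| + `|Q.[z]|.
    by rewrite -{1}(subrK Q.[z] Q.[y]) ler_normD.
  have h2 : `|Q.[y] - Q.[z]| <= `|Q.[y]| / 2.
    apply: le_trans lip _; rewrite subr0 divr1.
    apply: (@le_trans _ _ (8 * N%:R ^+ 2 * `|Q.[y]| * d)).
      by apply: ler_wpM2l => //; rewrite !mulr_ge0 ?exprn_ge0.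
    rewrite le_eqVlt; apply/orP; left; apply/eqP; rewrite /d; field.
    by rewrite pnatr_eq0 -lt0n.
  lra.
have Qz : `|Q.[z]| <= (16 * N%:R ^+ 2) `^ a * m.
  have : `|Q.[z]| * d `^ a <= m.
    have z1 : 0 <= z < 1 by lra.
    apply: le_trans (bQ z z1).
    by apply: ler_wpM2l => //; apply: ge0_ler_powR; rewrite ?nnegrE; lra.
  have -> : d `^ a = ((16 * N%:R ^+ 2) `^ a)^-1.
    by rewrite /d -powR_inv1 ?ltW // powRAC powR_inv1 ?powR_ge0.
  by rewrite ler_pdivrMr ?powR_gt0 // mulrC.
by move=> x /M' h; rewrite -mulrA; lra.
Qed.

Section endpoint.
Variables (a b : R) (a0 : 0 < a).
Variables (g : R -> R) (P : nat -> {poly R}) (e : nat -> R) (M S : R).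
Hypothesis apx : approximants (u_plus a b) g P e M S.

Let q : R := (4 `^ a)^-1.
Let s := geo_conv q (diff_bound M e).

Lemma u_plus_ge x : 0 <= x < 1 -> (1 - x) `^ a <= u_plus a b x.
Proof.
move=> x1; rewrite /u_plus /jacobi_weight /pos_part (max_r (ltW a0)).
rewrite ler_peMr ?powR_ge0 //.
apply: (@le_trans _ _ ((1 + x) `^ 0)); first by rewrite powRr0.
apply: ler_powR; first lra.
by rewrite le_max lexx.
Qed.

(** By [poly_endpoint_bound], layer j loses a factor of order 4^(a j) on [0, 1]; summing over j <= k
    gives 4^(a k) times the convolution of ratio 4^-a. *)
Lemma approximants_growth k x : 0 <= x <= 1 ->
  `|(P k).[x]| <= 2 * 16 `^ a * (4 `^ a) ^+ k * s k.
Proof.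
move=> x1.
have q0 : 0 < 4 `^ a :> R by exact: powR_gt0.
have lay j : `|(layer P j).[x]| <= 2 * 16 `^ a * (4 `^ a) ^+ j * diff_bound M e j.
  have := @poly_endpoint_bound a (diff_bound M e j) (2 ^ j) _ a0 _
    (size_layer apx j) _ x x1.
  rewrite expn_gt0 /= => /(_ isT) H.
  apply: le_trans (H _) _.
    move=> y y1; have y1' : -1 < y < 1 by lra.
    apply: le_trans (layer_le apx j y1').
    by apply: ler_wpM2l => //; exact: u_plus_ge.
  rewrite powRM ?exprn_ge0 // -natrX -expnM mulnC expnM natrX powR_exprn //.
  rewrite (_ : (2 ^ 2)%N%:R = 4 :> R) // le_eqVlt; apply/orP; left; apply/eqP.
  by ring.
elim: k => [|k IH]; first exact: (lay 0%N).
have -> : (P k.+1).[x] = (layer P k.+1).[x] + (P k).[x].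
  by rewrite /= hornerD hornerN subrK.
apply: le_trans (ler_normD _ _) _.
apply: le_trans (lerD (lay k.+1) IH) _.
rewrite le_eqVlt; apply/orP; left; apply/eqP; rewrite exprS /s /= /q.
by field; rewrite gt_eqF.
Qed.

Lemma endpoint_decay k x : 0 <= x < 1 -> 1 - x <= 4^-1 ^+ k ->
  `|g x| * u_plus a b x <= e k + 2 * 16 `^ a * 2 `^ `|pos_part b| * s k.
Proof.
move=> x1 xk; have x1' : -1 < x < 1 by lra.
have q0 : 0 < 4 `^ a :> R by exact: powR_gt0.
have s0 : 0 <= s k.
  apply: geo_conv_ge0; last by move=> j; exact: (diff_bound_ge0 apx).
  by rewrite /q invr_ge0 ltW.
have w0 : 0 <= u_plus a b x by exact: jacobi_weight_ge0.
apply: (@le_trans _ _ (`|g x - (P k).[x]| * u_plus a b x +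
    `|(P k).[x]| * u_plus a b x)).
  rewrite -mulrDl ler_wpM2r //.
  by rewrite -{1}(subrK (P k).[x] (g x)) ler_normD.
apply: lerD; first exact: (apx_err apx).
apply: (@le_trans _ _ ((2 * 16 `^ a * (4 `^ a) ^+ k * s k) *
    ((((4 `^ a) ^+ k)^-1) * 2 `^ `|pos_part b|))).
  apply: ler_pM => //; first by apply: approximants_growth; lra.
  rewrite /u_plus /jacobi_weight; apply: ler_pM; rewrite ?powR_ge0 //.
    rewrite /pos_part (max_r (ltW a0)) -exprVn.
    have -> : (4 `^ a)^-1 = 4^-1 `^ a :> R.
      by rewrite -powR_inv1 ?powR_ge0 // powRAC powR_inv1.
    rewrite -powR_exprn //; apply: ge0_ler_powR; rewrite ?nnegrE //; try lra.
    exact: ltW.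
  by apply: powR_le_cst; lra.
rewrite le_eqVlt; apply/orP; left; apply/eqP; field.
by rewrite gt_eqF // exprn_gt0.
Qed.

End endpoint.

Lemma le_Rintegral_subset (A B : set R) (k f : R -> R) :
  measurable A -> measurable B -> A `<=` B ->
  mu.-integrable A (EFin \o k) -> mu.-integrable B (EFin \o f) ->
  (forall x, B x -> 0 <= f x) -> (forall x, A x -> `|k x| <= f x) ->
  \int[mu]_(x in A) `|k x| <= \int[mu]_(x in B) f x.
Proof.
move=> mA mB AB ik iF f0 kf.
have ifA : mu.-integrable A (EFin \o f) by exact: integrableS iF.
apply: (@le_trans _ _ (\int[mu]_(x in A) f x)).
  by apply: le_Rintegral => //; exact: (integrable_abse ik).
rewrite /Rintegral; apply: fine_le; try exact: integrable_fin_num.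
apply: ge0_subset_integral => //.
exact: measurable_int iF.
Qed.

End far_from_the_singularity.

(** * The integral far from the singularity *)

Section far_integral.
Context (R : realType).
Notation mu := (@lebesgue_measure R).

Definition far_right (t : R) : set R :=
  [set x | 0 <= x < 1 /\ half_gap t < `|x - t|].

Lemma measurable_far_right t : measurable (far_right t).
Proof.
rewrite (_ : far_right t = `[0, 1[ `&` [set x | `|x - t| \in `]half_gap t, +oo[]).
  by apply: measurableI => //; exact: measurable_normB_itv.
by apply/seteqP; split => x /=; rewrite !in_itv /= andbT.
Qed.

Lemma far_right_oo t : far_right t `<=` `](-1 : R), 1[.
Proof. by move=> x [/andP[x0 x1] _] /=; rewrite in_itv /= x1 andbT; lra. Qed.

(** Only the behaviour at the endpoint 1 is kept: the logarithm at -1 is dropped from the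
    denominator, and for a = 0 the coefficient of the other one is at least 1. *)
Lemma u_two_le (a b t : R) : -1 < t < 1 ->
  0 <= u_two a b t /\
  u_two a b t <= (1 - t) `^ neg_part a * 2 `^ `|neg_part b|
     / (1 + (a == 0)%:R * `|ln (1 - t)|).
Proof.
move=> t1; rewrite /u_two.
set X := u_plus a b (-1) * _; set Y := u_plus a b 1 * _.
have X0 : 0 <= X by rewrite mulr_ge0 ?jacobi_weight_ge0.
have Y0 : (a == 0)%:R <= Y.
  case: eqVneq => [a0|_] /=; last by rewrite mulr_ge0 ?jacobi_weight_ge0.
  rewrite /Y /u_plus /u_minus /jacobi_weight /pos_part /neg_part a0 oppr0 maxxx.
  rewrite !powRr0 !mul1r.
  have c1 (c : R) : 0 <= c -> 1 <= (1 + 1) `^ c.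
    move=> c0; apply: (@le_trans _ _ ((1 + 1) `^ 0)); first by rewrite powRr0.
    by apply: ler_powR => //; lra.
  by apply: mulr_ege1; apply: c1; rewrite le_max lexx.
have L0 := normr_ge0 (ln (1 - t)).
have D0 : 0 <= X * `|ln (1 + t)| by rewrite mulr_ge0.
have D1 : (a == 0)%:R * `|ln (1 - t)| <= Y * `|ln (1 - t)|.
  exact: ler_wpM2r.
have D2 : 0 <= (a == 0)%:R * `|ln (1 - t)| by rewrite mulr_ge0.
have um : 0 <= u_minus a b t by exact: jacobi_weight_ge0.
split; first by rewrite divr_ge0 //; lra.
apply: ler_pM => //; first by rewrite invr_ge0; lra.
  rewrite /u_minus /jacobi_weight; apply: ler_wpM2l; rewrite ?powR_ge0 //.
  have [h|h] := leP 1 (1 + t); first by apply: powR_le_cst; lra.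
  have n0 : 0 <= neg_part b by rewrite /neg_part le_max lexx.
  rewrite (ger0_norm n0); apply: ge0_ler_powR; rewrite ?nnegrE //; lra.
by rewrite lef_pV2 ?posrE; lra.
Qed.

Section far_right_bound.
Variables (a b : R) (ha : -1 < a) (hb : -1 < b).
Variables (g : R -> R) (P : nat -> {poly R}) (e : nat -> R) (M S : R).
Hypothesis apx : approximants (u_plus a b) g P e M S.
Hypothesis cg : {in `](-1 : R), 1[, continuous g}.
Variables (t : R) (t1 : -1 < t < 1).

Local Notation kern := (hilbert_kernel a b g t).

Lemma integrable_far_right : mu.-integrable (far_right t) (EFin \o kern).
Proof.
apply: (integrable_kernel ha hb apx cg (half_gap_gt0 t1)).
- exact: measurable_far_right.
- exact: far_right_oo.
- by move=> x [_ /ltW].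
Qed.

Lemma u_minus_ge x : 0 <= x < 1 -> (1 - x) `^ neg_part a <= u_minus a b x.
Proof.
move=> x1; rewrite /u_minus /jacobi_weight ler_peMr ?powR_ge0 //.
apply: (@le_trans _ _ ((1 + x) `^ 0)); first by rewrite powRr0.
by apply: ler_powR; [lra|rewrite le_max lexx].
Qed.

Lemma far_kernel_le x : far_right t x ->
  `|kern x| <= 9 * (`|g x| * u_plus a b x) * (1 - x) `^ (- neg_part a)
    / ((1 - x) + (1 - t)).
Proof.
move=> [x1 xt]; have h := far_dist_ge t1 x1 xt.
have x1' : -1 < x < 1 by lra.
have xt0 : 0 < `|x - t| by apply: lt_trans xt; exact: half_gap_gt0.
have y0 : 0 < (1 - x) `^ neg_part a by apply: powR_gt0; lra.
have um := u_minus_ge x1.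
have D0 : 0 < (1 - x) + (1 - t) by move: t1; lra.
have -> : `|kern x| = `|g x| * u_plus a b x / u_minus a b x / `|x - t|.
  rewrite /hilbert_kernel mulrAC normrM normfV; congr (_ / _).
  exact: normr_weighted.
have G0 : 0 <= `|g x| * u_plus a b x by rewrite mulr_ge0 ?jacobi_weight_ge0.
rewrite powRN.
rewrite [leRHS](_ : _ = `|g x| * u_plus a b x *
  (((1 - x) `^ neg_part a)^-1 * (9 / (1 - x + (1 - t))))); last by ring.
rewrite -mulrA; apply: ler_wpM2l => //.
apply: ler_pM; rewrite ?invr_ge0 ?normr_ge0 ?jacobi_weight_ge0 //.
  by rewrite lef_pV2 ?posrE // jacobi_weight_gt0.
by rewrite ler_pdivlMr // mulrC ler_pdivrMr.
Qed.

(** Dropping 1 - t from the denominator leaves 1 / (1 - x), so [endpoint_decay] supplies the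
    hypothesis of [dyadic_integrable] centred at 1, uniformly in t. The constant is 72 = 8 times 9,
    from 2 / q with q = 1/4 and from [far_dist_ge]. *)
Lemma far_right_pos : 0 < a ->
  \int[mu]_(x in far_right t) `|kern x| <=
    72 * (1 + 2 * 16 `^ a * 2 `^ `|pos_part b| * 2 / (1 - (4 `^ a)^-1)) * (M + S).
Proof.
move=> a0; set C0 := 2 * 16 `^ a * 2 `^ `|pos_part b|.
have C00 : 0 <= C0 by rewrite !mulr_ge0 ?powR_ge0.
have q0 : 0 < 4 `^ a :> R by exact: powR_gt0.
set q := (4 `^ a)^-1.
have q01 : 0 <= q < 1.
  rewrite invr_ge0 ltW //= invf_lt1 //.
  have : 1 `^ a < 4 `^ a :> R by apply: gt0_ltr_powR; rewrite ?nnegrE //; lra.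
  by rewrite powR1.
have M0 := approximants_M_ge0 apx; have S0 := approximants_S_ge0 apx.
set s := geo_conv q (diff_bound M e).
have s0 k : 0 <= s k.
  apply: geo_conv_ge0; first by case/andP: q01.
  by move=> j; exact: (diff_bound_ge0 apx).
have dist x : far_right t x -> `|x - 1| = 1 - x.
  by move=> [x1 _]; rewrite ltr0_norm; lra.
have na : neg_part a = 0 by rewrite /neg_part max_l //; lra.
have [_ H] : mu.-integrable (far_right t) (EFin \o kern) /\
    \int[mu]_(x in far_right t) `|kern x| <=
      2 / 4^-1 * (S * 9 + C0 * ((M + 2 * S) / (1 - q)) * 9).
  apply: (@dyadic_integrable R _ kern 1 1 4^-1 _
    (fun k => e k * 9 + C0 * s k * 9)).
  - exact: measurable_far_right.
  - apply: (@measurable_funS _ _ _ _ `](-1 : R), 1[) => //.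
      exact: far_right_oo.
    exact: measurable_kernel.
  - lra.
  - lra.
  - move=> x fx; rewrite dist //; case: fx => x1 _; lra.
  - move=> k x fx; rewrite dist // !mul1r => /andP[_ xk].
    have [x1 _] := fx.
    apply: le_trans (far_kernel_le fx) _.
    rewrite na oppr0 powRr0 mulr1; apply: ler_pM.
    + do 2 apply: mulr_ge0 => //; exact: jacobi_weight_ge0.
    + by rewrite invr_ge0; move: t1; lra.
    + rewrite -mulrDl mulrC ler_pM2r //.
      exact: (endpoint_decay a0 apx x1 xk).
    + by rewrite lef_pV2 ?posrE; move: t1; lra.
  - by move=> k; rewrite addr_ge0 // mulr_ge0 ?(apx_ge0 apx) // mulr_ge0.
  - move=> n; rewrite big_split /= -!mulr_suml -mulr_sumr.
    apply: lerD; apply: ler_wpM2r => //; first exact: (apx_sum apx).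
    apply: ler_wpM2l => //.
    apply: le_trans (sum_geo_conv n q01 (diff_bound_ge0 apx)) _.
    apply: ler_wpM2r; last exact: (sum_diff_bound apx).
    by rewrite invr_ge0; lra.
apply: le_trans H _.
have i4 : 2 / 4^-1 = 8 :> R by rewrite invrK -natrM.
rewrite i4.
have qi : 0 <= (1 - q)^-1 by rewrite invr_ge0; lra.
have CQ : 0 <= C0 * (1 - q)^-1 by rewrite mulr_ge0.
have : 0 <= C0 * (1 - q)^-1 * M by rewrite mulr_ge0.
have -> : C0 * ((M + 2 * S) / (1 - q)) * 9 =
  9 * (C0 * (1 - q)^-1 * M) + 18 * (C0 * (1 - q)^-1 * S) by ring.
have -> : 72 * (1 + C0 * 2 / (1 - q)) * (M + S) = 72 * M + 72 * S +
  144 * (C0 * (1 - q)^-1 * M) + 144 * (C0 * (1 - q)^-1 * S) by ring.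
lra.
Qed.

Lemma Rintegral_abs_split (A B : set R) (k : R -> R) :
  measurable A -> measurable B -> mu.-integrable A (EFin \o k) ->
  \int[mu]_(x in A) `|k x| =
  \int[mu]_(x in A `&` B) `|k x| + \int[mu]_(x in A `\` B) `|k x|.
Proof.
move=> mA mB ik.
have ika : mu.-integrable A (EFin \o (fun x => `|k x|)) by exact: (integrable_abse ik).
rewrite -{1}(setUIDK A B) Rintegral_setU //.
- exact: measurableI.
- exact: measurableD.
- by rewrite setUIDK.
- by apply/disj_setPS => x [[_ ?] [_ ?]].
Qed.

(** The integral of (1 - x)^a / ((1 - x) + s), with s = 1 - t, is split at 1 - x = s. On the inner
    part the denominator is at least s, which gives the order s^a. On the outer part it is at least
    1 - x, and (1 - x)^(a-1) has a primitive that is a logarithm for a = 0 and a power otherwise. *)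
Lemma far_right_nonpos : a <= 0 ->
  \int[mu]_(x in far_right t) `|kern x| <=
    36 / (1 - 2^-1 `^ (a + 1)) * M * (1 - t) `^ a +
    9 * M * (if a == 0 then `|ln (1 - t)| else (- a)^-1 * (1 - t) `^ a).
Proof.
move=> a0; have M0 := approximants_M_ge0 apx.
set s := 1 - t; have s0 : 0 < s by move: t1; rewrite /s; lra.
have na : - neg_part a = a by rewrite /neg_part max_r; move: a0; lra.
have mF := measurable_far_right t.
have mB : measurable [set x : R | `|x - 1| \in `[0, s]].
  exact: measurable_normB_itv.
have ik := integrable_far_right.
have dist x : far_right t x -> `|x - 1| = 1 - x.
  by move=> [x1 _]; rewrite ltr0_norm; lra.
have le x : far_right t x ->
    `|kern x| <= 9 * M * ((1 - x) `^ a / ((1 - x) + s)).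
  move=> fx; apply: le_trans (far_kernel_le fx) _.
  have [x1 _] := fx; have x1' : -1 < x < 1 by lra.
  rewrite na -/s [leLHS](_ : _ = `|g x| * u_plus a b x *
    (9 * ((1 - x) `^ a / (1 - x + s)))); last by ring.
  rewrite [leRHS](_ : _ = M * (9 * ((1 - x) `^ a / (1 - x + s)))); last by ring.
  apply: ler_wpM2r; last exact: (apx_bound apx).
  by rewrite mulr_ge0 // divr_ge0 ?powR_ge0 //; lra.
rewrite (Rintegral_abs_split mF mB ik); apply: lerD.
  have mA : measurable (far_right t `&` [set x | `|x - 1| \in `[0, s]]).
    exact: measurableI.
  have [_ H] : mu.-integrable (far_right t `&` [set x | `|x - 1| \in `[0, s]])
      (EFin \o kern) /\
    \int[mu]_(x in far_right t `&` [set x | `|x - 1| \in `[0, s]]) `|kern x| <=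
      4 * (9 * M / s * s `^ (a + 1) / (1 - 2^-1 `^ (a + 1))).
    apply: (@integral_powR_norm R _ kern 1 s a (9 * M / s)) => //.
    - by rewrite divr_ge0 ?mulr_ge0 // ltW.
    - apply: (@measurable_funS _ _ _ _ `](-1 : R), 1[) => //.
        by move=> x [/far_right_oo].
      exact: measurable_kernel.
    - move=> x [fx] /=; rewrite in_itv /= => /andP[_ ->]; rewrite andbT dist //.
      by case: fx => ? _; lra.
    - move=> x [fx _]; rewrite dist //; apply: le_trans (le x fx) _.
      have [x1 _] := fx.
      rewrite [leRHS](_ : _ = 9 * M * ((1 - x) `^ a / s)); last by ring.
      apply: ler_wpM2l; first by rewrite mulr_ge0.
      by apply: ler_wpM2l; rewrite ?powR_ge0 // lef_pV2 ?posrE; lra.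
  apply: le_trans H _.
  have -> : s `^ (a + 1) = s `^ a * s.
    by rewrite powRD ?powRr1 ?ltW //; apply/implyP => _; rewrite gt_eqF.
  rewrite le_eqVlt; apply/orP; left; apply/eqP.
  have a1 : 0 < a + 1 by move: ha; lra.
  have /andP[_ h1] := half_powR_lt1 a1.
  by field; rewrite !gt_eqF //; lra.
set A := _ `\` _.
have mA : measurable A by exact: measurableD.
have ikA : mu.-integrable A (EFin \o kern) by apply: integrableS ik => // x [].
have AP x : A x -> far_right t x /\ s < 1 - x.
  move=> [fx] /= ns; split => //; rewrite ltNge; apply/negP => h; apply: ns.
  by rewrite in_itv /= dist // h andbT; case: fx; lra.
have [s1|s1] := leP 1 s.
  have -> : A = set0.
    by rewrite -subset0 => x /AP[[x1 _] ?] /=; lra.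
  rewrite Rintegral_set0 mulr_ge0 ?mulr_ge0 //; case: ifP => // _.
  by rewrite mulr_ge0 ?powR_ge0 // invr_ge0; lra.
pose f x : R := 9 * M * (1 - x) `^ (a - 1).
pose H x : R := if a == 0 then - ln (1 - x) else (- a)^-1 * (1 - x) `^ a.
have [iF FE] : mu.-integrable `[0, 1 - s] (EFin \o (fun x => (1 - x) `^ (a - 1))) /\
   \int[mu]_(x in `[0, 1 - s]) (1 - x) `^ (a - 1) = H (1 - s) - H 0.
  apply: Rintegral_FTC; first lra.
    move=> x xs; have x0 : 0 < 1 - x by lra.
    rewrite /H; case: eqVneq => [->|an0].
      have := @is_derive1_comp R (@ln R) (fun x => 1 - x) x (1 - x)^-1 (-1).
      rewrite sub0r powR_inv1 ?ltW // => D.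
      have {}D : is_derive x 1 (@ln R \o (fun x => 1 - x)) ((1 - x)^-1 * -1).
        apply: D; first exact: is_derive1_ln.
        by apply: is_derive_eq; ring.
      have := is_deriveN D; rewrite mulrN1 opprK; exact.
    have := @is_derive1_comp R (fun y => y `^ a) (fun x => 1 - x) x
      (a * (1 - x) `^ (a - 1)) (-1).
    move=> D.
    have {}D : is_derive x 1 ((fun y => y `^ a) \o (fun x => 1 - x))
         (a * (1 - x) `^ (a - 1) * -1).
      apply: D; first exact: is_derive1_powR.
      by apply: is_derive_eq; ring.
    have := is_deriveZ (- a)^-1 D.
    rewrite (_ : _ *: _ = (1 - x) `^ (a - 1)); first exact.
    by rewrite /GRing.scale /=; field.
  move=> x xs; have x0 : 0 < 1 - x by lra.
  have D : is_derive x 1 ((fun y => y `^ (a - 1)) \o (fun x => 1 - x))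
      ((a - 1) * (1 - x) `^ (a - 1 - 1) * -1).
    apply: (@is_derive1_comp R (fun y => y `^ (a - 1)) (fun x => 1 - x)).
      exact: is_derive1_powR.
    by apply: is_derive_eq; ring.
  have {D} [D _] := D.
  exact/differentiable_continuous/derivable1_diffP.
have iFM : mu.-integrable `[0, 1 - s] (EFin \o f).
  have : mu.-integrable `[0, 1 - s]
     (fun x => (9 * M)%:E * ((1 - x) `^ (a - 1))%:E)%E by exact: integrableZl.
  by [].
apply: (@le_trans _ _ (\int[mu]_(x in `[0, 1 - s]) f x)).
  apply: le_Rintegral_subset => //.
  - by move=> x /AP[[x1 _] ?] /=; rewrite in_itv /=; lra.
  - by move=> x _; rewrite mulr_ge0 ?powR_ge0 // mulr_ge0.
  - move=> x /AP[fx xs]; apply: le_trans (le x fx) _; have [x1 _] := fx.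
    apply: ler_wpM2l; first by rewrite mulr_ge0.
    rewrite powRB; last by apply/implyP => _; rewrite gt_eqF //; lra.
    rewrite powRr1; last lra.
    apply: ler_wpM2l; first exact: powR_ge0.
    by rewrite lef_pV2 ?posrE; lra.
rewrite RintegralZl // FE; apply: ler_wpM2l; first by rewrite mulr_ge0.
rewrite /H subKr subr0; case: eqVneq => [_|an0].
  by rewrite ln1 oppr0 subr0 -normrN ler_norm.
by rewrite gerBl powR1 mulr1 invr_ge0; lra.
Qed.

End far_right_bound.
End far_integral.

(** * The weighted far integral, with the left half obtained by reflection *)

Section hilbert_bound.
Context (R : realType).
Notation mu := (@lebesgue_measure R).

Lemma far_right_bound (a b : R) : -1 < a -> -1 < b ->
  exists2 C : R, 0 <= C & forall g P e M S (t : R),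
    approximants (u_plus a b) g P e M S ->
    {in `](-1 : R), 1[, continuous g} -> -1 < t < 1 ->
    \int[mu]_(x in far_right t) `|hilbert_kernel a b g t x| * u_two a b t <=
      C * (M + S).
Proof.
move=> ha hb.
have B0 : 0 <= 2 `^ `|neg_part b| :> R by exact: powR_ge0.
have [a0|a0] := leP a 0; last first.
  set C := 72 * (1 + 2 * 16 `^ a * 2 `^ `|pos_part b| * 2 / (1 - (4 `^ a)^-1)).
  have C0 : 0 <= C.
    apply: mulr_ge0 => //; apply: addr_ge0 => //; apply: divr_ge0.
      by rewrite !mulr_ge0 ?powR_ge0.
    have q0 : 0 < 4 `^ a :> R by exact: powR_gt0.
    have : 1 `^ a < 4 `^ a :> R by apply: gt0_ltr_powR; rewrite ?nnegrE //; lra.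
    rewrite powR1 => h; have : (4 `^ a)^-1 < (1 : R) by rewrite invf_lt1.
    lra.
  exists (C * 2 `^ `|neg_part b|); first exact: mulr_ge0.
  move=> g P e M S t apx cg t1.
  have M0 := approximants_M_ge0 apx; have S0 := approximants_S_ge0 apx.
  have [u0 u1] := u_two_le a b t1.
  have na : neg_part a = 0 by rewrite /neg_part max_l //; lra.
  rewrite na powRr0 gt_eqF //= mul0r addr0 mul1r invr1 mulr1 in u1.
  rewrite mulrAC; apply: ler_pM => //; first exact: Rintegral_ge0.
  exact: (far_right_pos apx cg t1 a0).
set K1 := 36 / (1 - 2^-1 `^ (a + 1)).
have K10 : 0 <= K1.
  have a1 : 0 < a + 1 by lra.
  have /andP[_ h1] := half_powR_lt1 a1.
  by rewrite divr_ge0 //; lra.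
have na : neg_part a = - a by rewrite /neg_part max_r //; lra.
(* The inverse is 0 when a = 0; the summand 1 then accounts for the logarithmic term. *)
exists ((K1 + 9 * (1 + (- a)^-1)) * 2 `^ `|neg_part b|).
  by rewrite mulr_ge0 // addr_ge0 // mulr_ge0 // addr_ge0 // invr_ge0; lra.
move=> g P e M S t apx cg t1.
have M0 := approximants_M_ge0 apx; have S0 := approximants_S_ge0 apx.
have [u0 u1] := u_two_le a b t1.
have I1 := far_right_nonpos ha hb apx cg t1 a0.
rewrite -/K1 in I1.
rewrite na powRN in u1.
have L0 := normr_ge0 (ln (1 - t)).
set L := `|ln (1 - t)| in I1 u1 L0.
have Y0 : 0 < (1 - t) `^ a by apply: powR_gt0; lra.
set D2 := 2 `^ `|neg_part b| in B0 u1 *.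
have an : 0 <= (- a)^-1 by rewrite invr_ge0; lra.
have T0 : 0 <= (K1 + 9 * (1 + (- a)^-1)) * D2.
  by rewrite mulr_ge0 // addr_ge0 // mulr_ge0 // addr_ge0.
apply: (@le_trans _ _ ((K1 + 9 * (1 + (- a)^-1)) * D2 * M)); last first.
  by rewrite ler_wpM2l // lerDl.
apply: le_trans (ler_pM _ u0 I1 u1) _; first exact: Rintegral_ge0.
case: eqVneq => [a00|an0] /=.
  rewrite a00 !powRr0 invr1 !mul1r !mulr1 oppr0 invr0 addr0 mulr1.
  rewrite mulrA ler_pdivrMr; last by rewrite ltr_wpDr.
  have -> : (K1 * M + 9 * M * L) * D2 = (K1 + 9 * L) * (D2 * M) by ring.
  have -> : (K1 + 9) * D2 * M * (1 + L) = (K1 + 9) * (1 + L) * (D2 * M) by ring.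
  apply: ler_wpM2r; first exact: mulr_ge0.
  have : 0 <= K1 * L by rewrite mulr_ge0.
  lra.
rewrite mul0r addr0 invr1 mulr1.
rewrite [leLHS](_ : _ = (K1 + 9 * (- a)^-1) * (D2 * M)); last first.
  by field; rewrite an0 gt_eqF.
rewrite -[leRHS]mulrA; apply: ler_wpM2r; first exact: mulr_ge0.
lra.
Qed.

Lemma jacobi_weight_opp (p q x : R) :
  jacobi_weight p q (- x) = jacobi_weight q p x.
Proof. by rewrite /jacobi_weight opprK mulrC. Qed.

Lemma u_two_opp (a b t : R) : u_two b a (- t) = u_two a b t.
Proof.
rewrite /u_two /u_minus /u_plus.
have E p q (c : R) : jacobi_weight p q c = jacobi_weight q p (- c).
  by rewrite jacobi_weight_opp.
rewrite jacobi_weight_opp opprK.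
rewrite [jacobi_weight _ _ (-1)]jacobi_weight_opp.
rewrite [jacobi_weight (neg_part b) _ (-1)]jacobi_weight_opp.
rewrite [jacobi_weight (pos_part b) _ 1]E [jacobi_weight (neg_part b) _ 1]E.
by congr (_ / _); ring.
Qed.

Lemma approximants_opp (a b : R) g P e M S :
  approximants (u_plus a b) g P e M S ->
  approximants (u_plus b a) (g \o -%R) (fun k => P k \Po - 'X) e M S.
Proof.
case=> sP eP bP e0 sS wP.
have I (x : R) : -1 < x < 1 -> -1 < - x < 1 by lra.
have uE x : u_plus b a x = u_plus a b (- x) by rewrite /u_plus jacobi_weight_opp.
split => //.
- by move=> k; rewrite size_comp_poly2 // size_polyN size_polyX.
- move=> k x x1 /=; rewrite uE horner_comp hornerN hornerX; exact/eP/I.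
- by move=> x x1 /=; rewrite uE; exact/bP/I.
- by move=> x x1; rewrite uE; exact/wP/I.
Qed.

Lemma continuous_oppr_oo (g : R -> R) :
  {in `](-1 : R), 1[, continuous g} ->
  {in `](-1 : R), 1[, continuous (g \o -%R)}.
Proof.
move=> cg x; rewrite in_itv /= => x1.
apply: continuous_comp; first exact: oppr_continuous.
by apply: cg; rewrite in_itv /=; lra.
Qed.

Lemma hilbert_kernel_opp (a b t x : R) (g : R -> R) :
  `|hilbert_kernel a b g t (- x)| = `|hilbert_kernel b a (g \o -%R) (- t) x|.
Proof.
rewrite /hilbert_kernel jacobi_weight_opp /= opprK.
rewrite (_ : - x - t = - (x + t)); last by ring.
by rewrite invrN mulrN mulNr normrN.
Qed.

Lemma half_gap_opp (t : R) : half_gap (- t) = half_gap t.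
Proof. by rewrite /half_gap normrN. Qed.

(** The reflection x -> -x exchanges a and b, sends t to -t, and maps the part of the far set with x
    < 0 into the right far set of -t. *)
Lemma far_bound (a b : R) : -1 < a -> -1 < b ->
  exists2 C : R, 0 <= C & forall g P e M S (t : R),
    approximants (u_plus a b) g P e M S ->
    {in `](-1 : R), 1[, continuous g} -> -1 < t < 1 ->
    \int[mu]_(x in far t) `|hilbert_kernel a b g t x| * u_two a b t <=
      C * (M + S).
Proof.
move=> ha hb.
have [C1 C10 H1] := far_right_bound ha hb.
have [C2 C20 H2] := far_right_bound hb ha.
exists (C1 + C2); first exact: addr_ge0.
move=> g P e M S t apx cg t1.
have t1' : -1 < - t < 1 by lra.
have apx' := approximants_opp apx; have cg' := continuous_oppr_oo cg.
have {}H1 := H1 _ _ _ _ _ _ apx cg t1.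
have {}H2 := H2 _ _ _ _ _ _ apx' cg' t1'.
rewrite u_two_opp in H2.
have [u0 _] := u_two_le a b t1.
have mF := measurable_far t.
have ik : mu.-integrable (far t) (EFin \o hilbert_kernel a b g t).
  apply: (integrable_kernel ha hb apx cg (half_gap_gt0 t1)) => //.
    by move=> x [x1 _] /=; rewrite in_itv.
  by move=> x [_ /ltW].
have mB : measurable (`[0, 1[ : set R) by exact: measurable_itv.
rewrite (Rintegral_abs_split mF mB ik) mulrDl mulrDl; apply: lerD.
  rewrite (_ : far t `&` _ = far_right t) //.
  apply/seteqP; split => x /=; rewrite in_itv /=.
    by move=> [[_ h] x1].
  by move=> [x1 h]; split => //; split => //; lra.
apply: le_trans H2; apply: ler_wpM2r => //.
set B := far t `\` _.
have mB' : measurable B by exact: measurableD.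
have ik' := integrable_far_right hb ha apx' cg' t1'.
have iB : mu.-integrable B (EFin \o hilbert_kernel a b g t).
  by apply: integrableS ik => // x [].
have mk : measurable_fun B (fun x => (`|hilbert_kernel a b g t x|%:E)%E).
  have := measurable_int _ (integrable_abse iB); exact.
rewrite {1}/Rintegral ge0_integral_reflect //; last first.
rewrite /Rintegral; apply: fine_le.
- rewrite -(@ge0_integral_reflect R B
    (fun x => (`|hilbert_kernel a b g t x|%:E)%E) mB' mk) //.
  by apply: integrable_fin_num => //; exact: (integrable_abse iB).
- apply: integrable_fin_num; first exact: measurable_far_right.
  exact: (integrable_abse ik').
rewrite [leLHS](_ : _ = \int[mu]_(x in -%R @^-1` B)
    (`|hilbert_kernel b a (g \o -%R) (- t) x|%:E))%E; last first.
  by apply: eq_integral => x _; congr EFin; exact: hilbert_kernel_opp.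
apply: ge0_subset_integral => //.
- rewrite -[X in measurable X]setTI.
  exact: (oppr_measurable measurableT).
- exact: measurable_far_right.
- exact: (measurable_int _ (integrable_abse ik')).
- move=> x [[x1 h]] /=; rewrite in_itv /= => /negP n.
  split; last first.
    have -> : x - - t = - (- x - t) by ring.
    by rewrite normrN half_gap_opp.
  by move: n; rewrite negb_and -!ltNge => /orP[]; lra.
Qed.

End hilbert_bound.

(** * Weighted bound for the Hilbert transform in terms of approximation data *)

Section hilbert_transform.
Context (R : realType).
Notation mu := (@lebesgue_measure R).

Lemma u_two_le_minus (a b t : R) : 0 <= u_two a b t <= u_minus a b t.
Proof.
rewrite /u_two; set X := u_plus a b (-1) * _; set Y := u_plus a b 1 * _.
have X0 : 0 <= X by rewrite mulr_ge0 ?jacobi_weight_ge0.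
have Y0 : 0 <= Y by rewrite mulr_ge0 ?jacobi_weight_ge0.
have um : 0 <= u_minus a b t by exact: jacobi_weight_ge0.
have L1 : 0 <= X * `|ln (1 + t)| by rewrite mulr_ge0.
have L2 : 0 <= Y * `|ln (1 - t)| by rewrite mulr_ge0.
rewrite divr_ge0 //=; last lra.
by rewrite ler_pdivrMr ?ler_peMr //; lra.
Qed.

Definition truncated_hilbert (a b : R) (f : R -> R) (t eps : R) : R :=
  \int[mu]_(x in [set x | x \in `[(-1 : R), 1] /\ eps <= `|x - t|])
    (f x / (x - t) * jacobi_weight a b x).

(** The near part is of order 1 / u_minus(t), and [u_two] is at most [u_minus]; the far part is
    [far_bound]. *)
Lemma finite_hilbert_bound (a b : R) : -1 < a -> -1 < b ->
  exists2 C : R, 0 <= C & forall g P e M S (t : R),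
    approximants (u_plus a b) g P e M S ->
    {in `](-1 : R), 1[, continuous g} -> -1 < t < 1 ->
    cvg (truncated_hilbert a b g t eps @[eps --> 0^'+]) /\
    `|finite_hilbert a b g t| * u_two a b t <= C * (M + S).
Proof.
move=> ha hb; have [C C0 far_le] := far_bound ha hb.
set nc := weight_cst a b * weight_cst (- pos_part a) (- pos_part b).
have nc0 : 0 <= nc.
  have := weight_cst_ge1 a b; have := weight_cst_ge1 (- pos_part a) (- pos_part b).
  by move=> ? ?; rewrite mulr_ge0 //; lra.
exists (C + 104 * nc); first by rewrite addr_ge0 // mulr_ge0.
move=> g P e M S t apx cg t1.
have M0 := approximants_M_ge0 apx; have S0 := approximants_S_ge0 apx.
have cvgH := cvg_principal_value ha hb apx cg t1.
have [iN nearle] := near_integrable apx cg t1.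
have farle := far_le _ _ _ _ _ _ apx cg t1.
split; first by apply/cvg_ex; eexists; exact: cvgH.
have limE := cvg_lim (@Rhausdorff R) cvgH.
have -> : finite_hilbert a b g t = _ := limE _.
have ik : mu.-integrable (far t) (EFin \o hilbert_kernel a b g t).
  apply: (integrable_kernel ha hb apx cg (half_gap_gt0 t1)).
  - exact: measurable_far.
  - by move=> x [x1 _] /=; rewrite in_itv.
  - by move=> x [_ /ltW].
have /andP[u0 u1] := u_two_le_minus a b t.
have um0 : 0 < u_minus a b t by exact: jacobi_weight_gt0.
apply: (@le_trans _ _ ((\int[mu]_(x in far t) `|hilbert_kernel a b g t x| +
   104 * nc * (M + S) / u_minus a b t) * u_two a b t)).
  apply: ler_wpM2r => //; apply: le_trans (ler_normD _ _) _.
  apply: lerD.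
    by apply: le_normr_Rintegral => //; exact: measurable_far.
  apply: le_trans nearle; apply: le_normr_Rintegral => //.
  exact: measurable_normB_le.
rewrite mulrDl [leRHS]mulrDl; apply: lerD => //.
rewrite [leLHS](_ : _ = 104 * nc * (M + S) * (u_two a b t / u_minus a b t));
  last by ring.
apply: ler_piMr.
  by apply: mulr_ge0; [exact: mulr_ge0|exact: addr_ge0].
by rewrite ler_pdivrMr // mul1r.
Qed.

End hilbert_transform.

(** * Weighted best approximation *)

Section weighted_approximation.
Context (R : realType).
Variables (gamma delta : R) (hg : 0 <= gamma) (hd : 0 <= delta).
Implicit Types (f g : R -> R) (Q : {poly R}).

Local Notation w := (jacobi_weight gamma delta).
Local Notation norm := (weighted_norm gamma delta).
Local Notation E := (best_approx gamma delta).

Lemma continuous_powR (p y : R) : 0 < y -> {for y, continuous (@powR R ^~ p)}.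
Proof.
move=> y0; apply/differentiable_continuous/derivable1_diffP.
by case: (is_derive1_powR p y0).
Qed.

Lemma continuous_jacobi_weight (p q x : R) : -1 < x < 1 ->
  {for x, continuous (jacobi_weight p q)}.
Proof.
move=> x1; apply: continuousM.
  apply: (@continuous_comp _ _ _ (fun x : R => 1 - x) (@powR R ^~ p)).
    by apply: continuousB; [exact: cvg_cst|exact: cvg_id].
  by apply: continuous_powR; lra.
apply: (@continuous_comp _ _ _ (fun x : R => 1 + x) (@powR R ^~ q)).
  by apply: continuousD; [exact: cvg_cst|exact: cvg_id].
by apply: continuous_powR; lra.
Qed.

(** At an endpoint with a positive exponent the weight vanishes, so the product takes its limit
    value 0 whatever f is there. With exponent 0 the corresponding factor is constantly 1 and f
    itself is continuous. *)
Lemma C0_space_weighted_continuous f : C0_space gamma delta f ->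
  {within `[-1, 1], continuous (fun x => f x * w x)}.
Proof.
move=> [cf f1 fN1].
have lt11 : -1 < (1 : R) by lra.
apply/(continuous_within_itvP _ lt11); split.
- move=> x x1; apply: continuousM; first exact: cf.
  by apply: continuous_jacobi_weight; move: x1; rewrite in_itv.
- move: fN1; case: ifPn => [d0|]; last first.
    rewrite -leNgt => d0; have {}d0 : delta = 0 by apply/eqP; rewrite eq_le d0.
    move=> fN1; apply: cvgM => //; rewrite /jacobi_weight d0.
    apply: cvg_at_right_filter; apply: cvgM; last first.
      by rewrite !powRr0; under eq_fun do rewrite powRr0; exact: cvg_cst.
    apply: (@continuous_comp _ _ _ (fun x : R => 1 - x) (@powR R ^~ gamma)).
      by apply: continuousB; [exact: cvg_cst|exact: cvg_id].
    by apply: continuous_powR; lra.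
  by rewrite [w (-1)]/jacobi_weight subrr (powR0 (lt0r_neq0 d0)) !mulr0.
- move: f1; case: ifPn => [g0|]; last first.
    rewrite -leNgt => g0; have {}g0 : gamma = 0 by apply/eqP; rewrite eq_le g0.
    move=> f1; apply: cvgM => //; rewrite /jacobi_weight g0.
    apply: cvg_at_left_filter; apply: cvgM.
      by rewrite !powRr0; under eq_fun do rewrite powRr0; exact: cvg_cst.
    apply: (@continuous_comp _ _ _ (fun x : R => 1 + x) (@powR R ^~ delta)).
      by apply: continuousD; [exact: cvg_cst|exact: cvg_id].
    by apply: continuous_powR; lra.
  by rewrite [w 1]/jacobi_weight subrr (powR0 (lt0r_neq0 g0)) !(mul0r, mulr0).
Qed.

Lemma weighted_norm_ubound f : C0_space gamma delta f ->
  has_ubound [set `|f x| * w x | x in `[-1, 1]].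
Proof.
move=> Cf; have cf := C0_space_weighted_continuous Cf.
have /compact_bounded[M [_ bM]] :=
  continuous_compact cf (@segment_compact R (-1) 1).
exists (`|M| + 1) => _ [x x1 <-].
rewrite -[w x]ger0_norm ?jacobi_weight_ge0 // -normrM.
by apply: bM; [rewrite ltr_pwDr // ler_norm|exists x].
Qed.

Lemma weighted_norm_ge f x : C0_space gamma delta f -> -1 <= x <= 1 ->
  `|f x| * w x <= norm f.
Proof.
move=> /weighted_norm_ubound hu x1; apply: ub_le_sup => //.
by exists x => //=; rewrite in_itv.
Qed.

Lemma weighted_norm_le f m : (forall x, -1 <= x <= 1 -> `|f x| * w x <= m) ->
  norm f <= m.
Proof.
move=> fm; apply: ge_sup.
  by exists (`|f 0| * w 0); exists 0 => //; rewrite /= in_itv /=; lra.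
by move=> _ [x /= x1 <-]; apply: fm; move: x1; rewrite in_itv.
Qed.

(** True of every function, since [sup] is 0 on a set without supremum; hence 0 is a lower bound in
    the definition of [best_approx] for every f. *)
Lemma weighted_norm_ge0 f : 0 <= norm f.
Proof.
rewrite /weighted_norm; set A := [set _ | _ in _].
have [hA|nA] := pselect (has_sup A); last by rewrite sup_out.
have [[y Ay] _] := hA; apply: le_trans (sup_upper_bound hA Ay).
by case: Ay => x _ <-; rewrite mulr_ge0 ?jacobi_weight_ge0.
Qed.

Lemma cvg_onem_at_left : (1 - x : R) @[x --> 1^'-] --> 0^'+.
Proof.
move=> A [d /= d0 dA]; exists d => //= y /= yd y1; apply: dA => /=; last lra.
by rewrite sub0r normrN.
Qed.

Lemma cvg_oneD_at_right : (1 + x : R) @[x --> (-1)^'+] --> 0^'+.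
Proof.
move=> A [d /= d0 dA]; exists d => //= y /= yd y1; apply: dA => /=; last lra.
by rewrite sub0r normrN; move: yd; rewrite -normrN; congr (`|_| < _); ring.
Qed.

Lemma C0_space_poly Q : C0_space gamma delta (fun x => Q.[x]).
Proof.
have cQ x : {for x, continuous (fun x => Q.[x])} by exact: continuous_horner.
split => [x _||]; first exact: cQ.
- case: ifPn => h; last exact: (cvg_at_left_filter (cQ _)).
  rewrite (_ : 0 = Q.[1] * (0 * (1 + 1) `^ delta)); last by rewrite mul0r mulr0.
  apply: cvgM; first exact: (cvg_at_left_filter (cQ _)).
  apply: cvgM.
    exact: (cvg_comp _ _ cvg_onem_at_left (powR_cvg0 h)).
  apply: cvg_at_left_filter.
  apply: (@continuous_comp _ _ _ (fun x : R => 1 + x) (@powR R ^~ delta)).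
    by apply: continuousD; [exact: cvg_cst|exact: cvg_id].
  by apply: continuous_powR; lra.
- case: ifPn => h; last exact: (cvg_at_right_filter (cQ _)).
  rewrite (_ : 0 = Q.[-1] * ((1 - -1) `^ gamma * 0)); last by rewrite !mulr0.
  apply: cvgM; first exact: (cvg_at_right_filter (cQ _)).
  apply: cvgM; last exact: (cvg_comp _ _ cvg_oneD_at_right (powR_cvg0 h)).
  apply: cvg_at_right_filter.
  apply: (@continuous_comp _ _ _ (fun x : R => 1 - x) (@powR R ^~ gamma)).
    by apply: continuousB; [exact: cvg_cst|exact: cvg_id].
  by apply: continuous_powR; lra.
Qed.

Lemma C0_spaceB f g : C0_space gamma delta f -> C0_space gamma delta g ->
  C0_space gamma delta (fun x => f x - g x).
Proof.
move=> [cf f1 fN1] [cg g1 gN1]; split.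
- by move=> x x1; apply: continuousB; [exact: cf|exact: cg].
- move: f1 g1; case: ifPn => h f1 g1; last exact: cvgB.
  by rewrite -[0]subr0; under eq_fun do rewrite mulrBl; exact: cvgB.
- move: fN1 gN1; case: ifPn => h fN1 gN1; last exact: cvgB.
  by rewrite -[0]subr0; under eq_fun do rewrite mulrBl; exact: cvgB.
Qed.

Lemma best_approx_has_inf n f :
  has_inf [set norm (fun x => f x - Q.[x]) |
            Q in [set Q : {poly R} | (size Q <= n.+1)%N]].
Proof.
split; first by exists (norm (fun x => f x - (0 : {poly R}).[x])), 0 => //=;
  rewrite size_poly0.
by exists 0 => _ [Q _ <-]; exact: weighted_norm_ge0.
Qed.

Lemma best_approx_ge0 n f : 0 <= E n f.
Proof.
apply: lb_le_inf; first by case: (best_approx_has_inf n f).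
by move=> _ [Q _ <-]; exact: weighted_norm_ge0.
Qed.

Lemma best_approx_le n f Q : (size Q <= n.+1)%N ->
  E n f <= norm (fun x => f x - Q.[x]).
Proof.
move=> sQ; apply: ge_inf; first by case: (best_approx_has_inf n f).
by exists Q.
Qed.

Lemma best_approx_lt n f (z : R) : 0 < z -> exists Q : {poly R},
  (size Q <= n.+1)%N /\ norm (fun x => f x - Q.[x]) < E n f + z.
Proof.
move=> z0; have [_ [Q sQ <-] lt] := inf_adherent z0 (best_approx_has_inf n f).
by exists Q.
Qed.

Lemma best_approx_le_norm n f : E n f <= norm f.
Proof.
have := @best_approx_le n f 0; rewrite size_poly0 => /(_ isT).
by under eq_fun do rewrite horner0 subr0.
Qed.

Lemma best_approx_nonincr m n f : (m <= n)%N -> E n f <= E m f.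
Proof.
move=> mn; apply/ler_addgt0Pr => z z0.
have [Q [sQ lt]] := best_approx_lt m f z0.
apply: le_trans (ltW lt); apply: best_approx_le.
by rewrite (leq_trans sQ).
Qed.

Lemma best_approx_sub_poly n f Q : (size Q <= n.+1)%N ->
  E n (fun x => f x - Q.[x]) = E n f.
Proof.
move=> sQ.
have le g Q' : (size Q' <= n.+1)%N -> E n (fun x => g x - Q'.[x]) <= E n g.
  move=> sQ'; apply/ler_addgt0Pr => z z0.
  have [Q1 [sQ1 lt]] := best_approx_lt n g z0.
  apply: le_trans (ltW lt).
  have := @best_approx_le n (fun x => g x - Q'.[x]) (Q1 - Q').
  rewrite (leq_trans (size_polyD _ _)) ?geq_max ?size_polyN ?sQ1 // => /(_ isT).
  rewrite (_ : (fun x => _ - (Q1 - Q').[x]) = (fun x => g x - Q1.[x])) //.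
  by apply/funext => x; rewrite hornerD hornerN; ring.
apply: le_anti; rewrite le //=.
have := @le (fun x => f x - Q.[x]) (- Q); rewrite size_polyN => /(_ sQ).
rewrite (_ : (fun x => _ - (- Q).[x]) = f) //.
by apply/funext => x; rewrite hornerN opprK subrK.
Qed.

Local Notation "'BS'" := (best_approx_sum gamma delta).

Lemma best_approx_sum_nondecr f : nondecreasing_seq (BS f).
Proof.
apply/nondecreasing_seqP => n; rewrite /best_approx_sum /=.
case: n => [|n]; first by rewrite !big_geq.
by rewrite [leRHS]big_nat_recr //= lerDl divr_ge0 // best_approx_ge0.
Qed.

Lemma best_approx_sum_le_lim f n : cvgn (BS f) -> BS f n <= limn (BS f).
Proof.
move=> cf; exact: (nondecreasing_cvgn_le (@best_approx_sum_nondecr f) cf n).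
Qed.

(** Cauchy condensation: the block 2^n <= k < 2^(n+1) has 2^n terms, each at least E_(2^(n+1)) /
    2^(n+1), so it sums to at least half of E_(2^(n+1)). *)
Lemma best_approx_sum_dyadic f n :
  \sum_(k < n) E (2 ^ k.+1) f <= 2 * BS f (2 ^ n)%N.
Proof.
rewrite /best_approx_sum /=; elim: n => [|n IH].
  by rewrite big_ord0 big_geq ?mulr0.
rewrite big_ord_recr /= (@big_cat_nat _ _ _ (2 ^ n)%N) ?expn_gt0 ?leq_exp2l //=.
rewrite mulrDr; apply: lerD => //.
have p0 : 0 < (2 ^ n.+1)%N%:R :> R by rewrite ltr0n expn_gt0.
apply: (@le_trans _ _ (2 * \sum_(2 ^ n <= k < 2 ^ n.+1)
    (E (2 ^ n.+1) f / (2 ^ n.+1)%N%:R))).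
  rewrite sumr_const_nat expnS mul2n -addnn addnK -mulr_natr natrD.
  rewrite le_eqVlt; apply/orP; left; apply/eqP; field.
  by rewrite -natrD pnatr_eq0 addnn -mul2n -expnS expn_eq0.
apply: ler_wpM2l => //; apply: ler_sum_nat => k /andP[k1 k2].
apply: ler_pM; rewrite ?best_approx_ge0 ?invr_ge0 //.
  by apply: best_approx_nonincr; exact: ltnW.
by rewrite lef_pV2 ?posrE ?ltr0n ?expn_gt0 ?ler_nat.
Qed.

Lemma B0_norm_ge0 f : cvgn (BS f) -> 0 <= B0_norm gamma delta f.
Proof.
move=> cf; rewrite addr_ge0 ?weighted_norm_ge0 //.
by apply: le_trans (best_approx_sum_le_lim 0 cf); rewrite /best_approx_sum /= big_geq.
Qed.

(** The infimum is approached up to z / 2 times 2^-k, losses that add up to at most z. The degree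
    2^0, which [best_approx_sum_dyadic] leaves out, is bounded by the norm of f. *)
Lemma B0_approximants f (z : R) : 0 < z -> B0_space gamma delta f ->
  exists P e, approximants w f P e (norm f) (2 * B0_norm gamma delta f + z).
Proof.
move=> z0 [Cf cf].
have zk k : 0 < z / 2 * 2^-1 ^+ k.
  by rewrite mulr_gt0 ?divr_gt0 // exprn_gt0 // invr_gt0.
have /choice[P PP] : forall k, exists Q : {poly R}, (size Q <= (2 ^ k).+1)%N /\
    norm (fun x => f x - Q.[x]) < E (2 ^ k) f + z / 2 * 2^-1 ^+ k.
  by move=> k; exact: best_approx_lt.
exists P, (fun k => E (2 ^ k) f + z / 2 * 2^-1 ^+ k); split.
- by move=> k; case: (PP k).
- move=> k x x1; have [_ /ltW] := PP k; apply: le_trans.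
  apply: (@weighted_norm_ge (fun x => f x - (P k).[x])); last lra.
  by apply: C0_spaceB => //; exact: C0_space_poly.
- by move=> x x1; apply: weighted_norm_ge => //; lra.
- by move=> k; rewrite addr_ge0 ?best_approx_ge0 // ltW.
- move=> n; rewrite big_split /= -mulr_sumr.
  apply: lerD.
    case: n => [|n]; first by rewrite big_ord0 mulr_ge0 // B0_norm_ge0.
    rewrite big_ord_recl /= /B0_norm mulrDr; apply: lerD.
      by have := best_approx_le_norm 1 f; have := weighted_norm_ge0 f; lra.
    apply: le_trans (best_approx_sum_dyadic f n) _.
    by apply: ler_wpM2l => //; exact: best_approx_sum_le_lim.
  have h2 : 0 <= (2^-1 : R) < 1 by apply/andP; split; lra.
  have := sum_geometric_le n h2.
  have -> : (1 - 2^-1)^-1 = 2 :> R by field.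
  have z2 : 0 <= z / 2 by apply: divr_ge0 => //; exact: ltW.
  by move=> /(ler_wpM2l z2); lra.
- by move=> x x1; exact: jacobi_weight_gt0.
Qed.

End weighted_approximation.

(** * Gauss quadrature and the de la Vallee Poussin operator *)

(** The list collects the roots of odd multiplicity: splitting off a factor X - r toggles the
    presence of r, and a polynomial without real roots has constant sign. *)
Lemma sign_poly (R : realType) (q : {poly R}) : q != 0 ->
  exists rs : seq R, [/\ uniq rs, all (root q) rs &
    (forall x, 0 <= (q * \prod_(r <- rs) ('X - r%:P)).[x]) \/
    (forall x, (q * \prod_(r <- rs) ('X - r%:P)).[x] <= 0)].
Proof.
have [n sq] := ubnP (size q); elim: n q sq => // n IH q sq q0.
have [[r rq]|nr] := pselect (exists r, root q r); last first.
  exists nil; split => //; rewrite big_nil mulr1.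
  have ivt (x y : R) : q.[x] < 0 -> 0 < q.[y] -> False.
    wlog xy : x y q {sq IH q0} nr / x <= y => [hw qx qy|qx qy].
      have [xy|/ltW yx] := leP x y; first exact: (hw x y q).
      apply: (hw y x (- q)) => //; rewrite ?hornerN ?oppr_lt0 ?oppr_gt0 //.
      by move=> [r]; rewrite rootN => rq; apply: nr; exists r.
    have [] := @poly_ivt R q x y xy; first by rewrite (ltW qx) (ltW qy).
    by move=> r _ rq; apply: nr; exists r.
  have [h|h] := pselect (forall x, 0 <= q.[x]); first by left.
  right => x; rewrite leNgt; apply/negP => qx; apply: h => y.
  by rewrite leNgt; apply/negP => qy; exact: (ivt y x).
have [q1 qE] := factor_theorem _ _ rq.
have q10 : q1 != 0 by apply: contraNneq q0 => q10; rewrite qE q10 mul0r.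
have [|rs [urs rtrs sgn]] := IH q1 _ q10.
  by move: sq; rewrite qE size_Mmonic ?monicXsubC // size_XsubC addn2.
have rtq : all (root q) rs.
  by apply: sub_all rtrs => y; rewrite qE rootM => ->.
have [rrs|rrs] := boolP (r \in rs).
  exists (rem r rs); split; first exact: rem_uniq.
    by apply/allP => y /mem_rem /(allP rtq).
  have := sgn; rewrite (perm_big _ (perm_to_rem rrs)) big_cons /=.
  by rewrite mulrA -qE.
exists (r :: rs); split => //=; [by rewrite rrs|by rewrite rq|].
have E x : (q * \prod_(j <- r :: rs) ('X - j%:P)).[x] =
   (x - r) ^+ 2 * (q1 * \prod_(j <- rs) ('X - j%:P)).[x].
  by rewrite big_cons {1}qE !hornerM hornerXsubC; ring.
case: sgn => h; [left|right] => x; rewrite E.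
  by rewrite mulr_ge0 ?sqr_ge0.
by rewrite mulr_ge0_le0 ?sqr_ge0.
Qed.

(** * Orthonormal polynomials of an abstract positive linear functional *)

Section orthonormal.
Context (R : realType).
Variables (p : nat -> {poly R}) (L : {poly R} -> R).
Hypothesis size_p : forall j, size (p j) = j.+1.
Hypothesis L_linear : forall (c : R) (A B : {poly R}), L (c *: A + B) = c * L A + L B.
Hypothesis L_ge0 :
  forall Q, (forall x : R, -1 <= x <= 1 -> 0 <= Q.[x]) -> 0 <= L Q.
Hypothesis L_orth : forall i j, L (p i * p j) = (i == j)%:R.

Lemma functional0 : L 0 = 0.
Proof.
have := L_linear 1 0 0; rewrite scaler0 addr0 mul1r => h.
by apply: (addrI (L 0)); rewrite addr0.
Qed.

Lemma functionalD A B : L (A + B) = L A + L B.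
Proof. by rewrite -{1}(scale1r A) L_linear mul1r. Qed.

Lemma functionalZ c A : L (c *: A) = c * L A.
Proof. by rewrite -[c *: A]addr0 L_linear functional0 addr0. Qed.

Lemma functional_sum (I : Type) (r : seq I) (F : I -> {poly R}) :
  L (\sum_(i <- r) F i) = \sum_(i <- r) L (F i).
Proof.
elim: r => [|i r IH]; first by rewrite !big_nil functional0.
by rewrite !big_cons functionalD IH.
Qed.

Lemma orthonormal_expansion N (Q : {poly R}) : (size Q <= N)%N ->
  Q = \sum_(j < N) L (Q * p j) *: p j.
Proof.
move=> sQ.
have [c Qc] : exists c : nat -> R, Q = \sum_(j < N) c j *: p j.
  elim: N Q sQ => [|N IH] Q sQ.
    exists (fun=> 0); rewrite big_ord0; apply/eqP.
    by rewrite -size_poly_eq0 -leqn0.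
  pose d := Q`_N / (p N)`_N.
  have pN0 : (p N)`_N != 0.
    have -> : (p N)`_N = lead_coef (p N) by rewrite lead_coefE size_p.
    by rewrite lead_coef_eq0 -size_poly_eq0 size_p.
  have [|c cE] := IH (Q - d *: p N).
    apply/leq_sizeP => j; rewrite leq_eqVlt => /predU1P[<-|Nj].
      by rewrite coefB coefZ divfK // subrr.
    rewrite coefB coefZ (leq_sizeP _ _ sQ _ Nj).
    by rewrite (leq_sizeP (p N) N.+1 _ _ Nj) ?size_p // mulr0 subr0.
  exists (fun j => if j == N then d else c j).
  rewrite big_ord_recr /= eqxx -[LHS](subrK (d *: p N)) cE.
  by congr (_ + _); apply: eq_bigr => j _; rewrite ltn_eqF.
have cE (j : 'I_N) : L (Q * p j) = c j.
  rewrite Qc mulr_suml functional_sum (bigD1 j) //= big1 ?addr0.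
    by rewrite -scalerAl functionalZ L_orth eqxx mulr1.
  move=> i ij; rewrite -scalerAl functionalZ L_orth.
  by rewrite (inj_eq val_inj) (negbTE ij) mulr0.
by rewrite {1}Qc; apply: eq_bigr => j _; rewrite cE.
Qed.

Lemma functional_orth n (Q : {poly R}) : (size Q <= n)%N -> L (Q * p n) = 0.
Proof.
move=> sQ; rewrite (orthonormal_expansion sQ) mulr_suml functional_sum.
rewrite big1 // => j _.
by rewrite -scalerAl functionalZ L_orth ltn_eqF // mulr0.
Qed.

(** Definiteness comes from orthonormality through Parseval's identity. *)
Lemma functional_sqr_eq0 (Q : {poly R}) : L (Q * Q) = 0 -> Q = 0.
Proof.
move=> LQ; have sQ := leqnn (size Q).
have E := orthonormal_expansion sQ.
have LE : L (Q * Q) = \sum_(j < size Q) L (Q * p j) ^+ 2.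
  rewrite {2}E mulr_sumr functional_sum; apply: eq_bigr => j _.
  by rewrite -scalerAr functionalZ expr2.
rewrite E big1 // => j _.
have : \sum_(j < size Q) L (Q * p j) ^+ 2 == 0 by rewrite -LE LQ.
rewrite psumr_eq0; last by move=> i _; exact: sqr_ge0.
by move=> /allP /(_ j (mem_index_enum _)) /=; rewrite sqrf_eq0 => /eqP ->; rewrite scale0r.
Qed.

(* On [-1, 1] one has Q^2 <= K Q, hence L (Q^2) <= K L Q. *)
Lemma functional_ge0_eq0 (Q : {poly R}) : (forall x, 0 <= Q.[x]) -> L Q = 0 -> Q = 0.
Proof.
move=> Q0 LQ; apply: functional_sqr_eq0.
have cQ : {within `[(-1 : R), 1], continuous (fun x => Q.[x])}.
  by apply: continuous_in_subspaceT => x _; exact: continuous_horner.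
have lt11 : -1 <= (1 : R) by lra.
have [c _ cmax] := EVT_max lt11 cQ.
apply/le_anti/andP; split; last first.
  by apply: L_ge0 => x _; rewrite hornerM -expr2 sqr_ge0.
have : 0 <= L (Q.[c] *: Q + (-1) *: (Q * Q)).
  apply: L_ge0 => x x1; rewrite hornerD !hornerZ hornerM mulN1r -mulrBl.
  by rewrite mulr_ge0 // subr_ge0 cmax // in_itv.
by rewrite functionalD !functionalZ LQ mulr0 add0r mulN1r oppr_ge0.
Qed.

(** If p_n had fewer than n roots of odd multiplicity, its product with the corresponding linear
    factors would have constant sign, yet L would vanish on it by orthogonality. *)
Lemma orthonormal_roots n : exists rs : seq R,
  [/\ uniq rs, size rs = n & forall y, root (p n) y = (y \in rs)].
Proof.
have pn0 : p n != 0 by rewrite -size_poly_eq0 size_p.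
have [rs [urs rtrs sgn]] := sign_poly pn0.
have srs : (size rs < n.+1)%N by rewrite -(size_p n) max_poly_roots.
have nrs : (n <= size rs)%N.
  rewrite leqNgt; apply/negP => lt.
  have L0 : L (p n * \prod_(r <- rs) ('X - r%:P)) = 0.
    by rewrite mulrC functional_orth // size_prod_XsubC.
  have : p n * \prod_(r <- rs) ('X - r%:P) = 0.
    case: sgn => h; first exact: functional_ge0_eq0.
    apply/eqP; rewrite -oppr_eq0; apply/eqP; apply: functional_ge0_eq0.
      by move=> x; rewrite hornerN oppr_ge0.
    by rewrite -scaleN1r functionalZ L0 mulr0.
  move/eqP; rewrite mulf_eq0 (negbTE pn0) /=; apply/negP.
  by rewrite monic_neq0 // monic_prod_XsubC.
have sE : size rs = n by apply/eqP; rewrite eqn_leq nrs andbT -ltnS.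
exists rs; split => // y; apply/idP/idP => [ry|/(allP rtrs) //].
apply: contraT => yrs; have := @max_poly_roots _ (p n) (y :: rs) pn0.
by rewrite /= ry rtrs yrs urs => /(_ isT isT); rewrite size_p sE ltnn.
Qed.

(** Weights exact in degree less than n exist because a nonzero polynomial of such degree cannot
    vanish at all n nodes. Division by p_n, which vanishes at the nodes and is orthogonal to the
    quotient, extends exactness to degree 2n - 1. *)
Lemma gauss_quadrature n (rs : seq R) (Q : {poly R}) : uniq rs -> size rs = n ->
  (forall y, root (p n) y = (y \in rs)) -> (size Q <= n + n)%N ->
  \sum_(y <- rs) christoffel p n y * Q.[y] = L Q.
Proof.
move=> urs srs rsE sQ.
pose y (k : 'I_n) := rs`_k.
have yrs k : y k \in rs by rewrite mem_nth // srs.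
have sumE (F : R -> R) : \sum_(z <- rs) F z = \sum_(k < n) F (y k).
  by rewrite (big_nth 0) big_mkord srs.
pose A : 'M[R]_n := \matrix_(j, k) (p j).[y k].
have A_unit : A \in unitmx.
  rewrite -row_free_unit; apply: inj_row_free => v vA.
  pose q := \sum_(j < n) v 0 j *: p j.
  have sq : (size q <= n)%N.
    apply: leq_trans (size_sum _ _ _) _; apply/bigmax_leqP => j _.
    by apply: leq_trans (size_scale_leq _ _) _; rewrite size_p.
  have q0 : q = 0.
    apply: contraTeq sq => q0; rewrite -ltnNge -srs; apply: max_poly_roots => //.
    apply/allP => z zrs; rewrite /root.
    have [k kn <-] : exists2 k, (k < n)%N & rs`_k = z.
      by exists (index z rs); rewrite ?nth_index // -srs index_mem.
    have := congr1 (fun M : 'rV_n => M 0 (Ordinal kn)) vA; rewrite !mxE => h.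
    rewrite horner_sum; apply/eqP; rewrite -[RHS]h; apply: eq_bigr => j _.
    by rewrite hornerZ mxE.
  apply/rowP => j; rewrite mxE.
  have := congr1 (fun Q => L (Q * p j)) q0.
  rewrite mul0r functional0 /q mulr_suml functional_sum (bigD1 j) //= big1.
    by rewrite addr0 -scalerAl functionalZ L_orth eqxx mulr1.
  move=> i ij; rewrite -scalerAl functionalZ L_orth.
  by rewrite (inj_eq val_inj) (negbTE ij) mulr0.
have [om Aom] : exists om : 'cV[R]_n, A *m om = \col_j L (p j).
  by exists (invmx A *m \col_j L (p j)); rewrite mulKVmx.
have om_p j : (j < n)%N -> \sum_(k < n) om k 0 * (p j).[y k] = L (p j).
  move=> jn; move: Aom.
  move/(congr1 (fun M : 'cV_n => M (Ordinal jn) 0)); rewrite !mxE /= => <-.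
  by apply: eq_bigr => k _; rewrite mxE mulrC.
have om_small (q : {poly R}) : (size q <= n)%N -> \sum_(k < n) om k 0 * q.[y k] = L q.
  move=> sq; have [c ->] : exists c : nat -> R, q = \sum_(j < n) c j *: p j.
    by exists (fun j => L (q * p j)); exact: orthonormal_expansion.
  rewrite functional_sum; under eq_bigr do rewrite horner_sum mulr_sumr.
  rewrite exchange_big /=; apply: eq_bigr => j _.
  rewrite functionalZ -om_p // mulr_sumr; apply: eq_bigr => k _.
  by rewrite hornerZ mulrCA.
have pn0 : p n != 0 by rewrite -size_poly_eq0 size_p.
have om_all (q : {poly R}) : (size q <= n + n)%N -> \sum_(k < n) om k 0 * q.[y k] = L q.
  move=> sq; rewrite {2}(divp_eq q (p n)) functionalD functional_orth ?add0r.
    rewrite -om_small; last by rewrite -ltnS -(size_p n) ltn_modp.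
    apply: eq_bigr => k _; congr (_ * _).
    rewrite {1}(divp_eq q (p n)) hornerD hornerM.
    have /rootP -> : root (p n) (y k) by rewrite rsE.
    by rewrite mulr0 add0r.
  by rewrite size_divp // size_p /= leq_subLR.
pose D : 'M[R]_n := diag_mx om^T.
(* Exactness on p_i p_j reads A D A^T = 1. For square matrices then also D A^T A = 1, whose diagonal
   identifies the weights with the Christoffel numbers. *)
have AD : A *m (D *m A^T) = 1%:M.
  rewrite /D mul_diag_mx; apply/matrixP => i j; rewrite !mxE.
  rewrite (_ : (i == j)%:R = L (p i * p j)); last first.
    by rewrite L_orth (inj_eq val_inj).
  rewrite -om_all; last first.
    apply: leq_trans (size_polyMleq _ _) _; rewrite !size_p addnS /=.
    by rewrite addSn -addnS leq_add // ltnW.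
  by apply: eq_bigr => k _; rewrite !mxE hornerM mulrCA.
have omE k : om k 0 = christoffel p n (y k).
  have := mulmx1C AD; rewrite /D mul_diag_mx; move/matrixP => /(_ k k); rewrite !mxE eqxx.
  under eq_bigr do rewrite !mxE -mulrA -expr2.
  rewrite -mulr_sumr => h; rewrite /christoffel.
  set T := \sum_(i < n) _ in h *.
  have T0 : T != 0.
    by apply: contra_eq_neq h => ->; rewrite mulr0 eq_sym oner_eq0.
  by apply: (mulIf T0); rewrite h mulVf.
rewrite sumE -om_all //; by apply: eq_bigr => k _; rewrite omE.
Qed.

Lemma vp_operator_sum n m (f : R -> R) (rs : seq R) x : uniq rs ->
  (forall y, root (p n) y = (y \in rs)) ->
  vp_operator p n m f x = \sum_(y <- rs) (f y * christoffel p n y *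
    \sum_(j < n + m) (vp_coef n m j * (p j).[x] * (p j).[y])).
Proof.
move=> urs rsE; rewrite /vp_operator [RHS]fsbig_seq //.
rewrite (_ : [set y | root (p n) y] = [set` rs]) //.
by apply/seteqP; split => y /=; rewrite rsE.
Qed.

Lemma vp_operator_poly n m (f : R -> R) : exists Q : {poly R},
  (size Q <= n + m)%N /\ vp_operator p n m f = horner Q.
Proof.
have [rs [urs _ rsE]] := orthonormal_roots n.
exists (\sum_(y <- rs) \sum_(j < n + m)
  (f y * christoffel p n y * (vp_coef n m j * (p j).[y])) *: p j); split.
  apply: leq_trans (size_sum _ _ _) _; apply/bigmax_leqP_seq => y _ _.
  apply: leq_trans (size_sum _ _ _) _; apply/bigmax_leqP => j _.
  by apply: leq_trans (size_scale_leq _ _) _; rewrite size_p.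
apply/funext => x; rewrite (vp_operator_sum _ _ _ urs rsE) horner_sum.
apply: eq_bigr => y _; rewrite horner_sum mulr_sumr; apply: eq_bigr => j _.
by rewrite hornerZ; ring.
Qed.

Lemma vp_operatorB n m (f g : R -> R) x :
  vp_operator p n m (fun x => f x - g x) x =
  vp_operator p n m f x - vp_operator p n m g x.
Proof.
have [rs [urs _ rsE]] := orthonormal_roots n.
rewrite !(vp_operator_sum _ _ _ urs rsE) -sumrB; apply: eq_bigr => y _.
by ring.
Qed.

(* In V_n^m P only moments of P p_j with deg (P p_j) <= 2n - 1 occur, on which
   the Gauss rule is exact. *)
Lemma vp_operator_id n m (Q : {poly R}) x : (0 < m)%N ->
  (m < n)%N -> (size Q <= (n - m).+1)%N -> vp_operator p n m (horner Q) x = Q.[x].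
Proof.
move=> m0 mn sQ; have [rs [urs srs rsE]] := orthonormal_roots n.
rewrite (vp_operator_sum _ _ _ urs rsE).
under eq_bigr do rewrite mulr_sumr.
rewrite exchange_big /=.
transitivity (\sum_(j < n + m) vp_coef n m j * (p j).[x] * L (Q * p j)).
  apply: eq_bigr => j _; rewrite -(gauss_quadrature urs srs rsE).
    by rewrite mulr_sumr; apply: eq_bigr => y _; rewrite hornerM; ring.
  apply: leq_trans (size_polyMleq _ _) _; rewrite size_p addnS /=.
  have jnm := ltn_ord j; apply: (@leq_trans ((n - m).+1 + (n + m).-1)).
    by rewrite leq_add // -ltnS prednK // (leq_ltn_trans _ jnm).
  by rewrite addSn -addnS prednK ?(leq_ltn_trans _ jnm) // addnCA subnK // ltnW.
rewrite {2}(orthonormal_expansion sQ) horner_sum.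
have le : ((n - m).+1 <= n + m)%N.
  by rewrite (leq_ltn_trans (leq_subr m n)) // -addn1 leq_add2l; case: (m) m0.
rewrite (big_ord_widen _ (fun j => (L (Q * p j) *: p j).[x]) le) [RHS]big_mkcond.
apply: eq_bigr => j _; rewrite /vp_coef ltnS; case: ifP => jn.
  by rewrite hornerZ; ring.
rewrite functional_orth ?mulr0 //.
by rewrite (leq_trans sQ) // ltnNge jn.
Qed.

End orthonormal.

(** * The functional given by integration against a Jacobi weight *)

Section jacobi_functional.
Context (R : realType).
Notation mu := (@lebesgue_measure R).
Variables (alpha beta : R) (halpha : -1 < alpha) (hbeta : -1 < beta).

Lemma integrable_itv_oo_cc (f : R -> R) (c d : R) :
  mu.-integrable `]c, d[ (EFin \o f) -> mu.-integrable `[c, d] (EFin \o f).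
Proof.
move=> /integrableP[mf fin]; apply/integrableP; split.
  apply/measurable_EFinP; apply: (@measurable_fun_itv_cc _ _ _ false true).
  exact/measurable_EFinP.
have mf1 : measurable_fun `]c, d] (EFin \o f).
  by apply/emeasurable_fun_itv_bndo_bndcP.
rewrite -integral_itv_obnd_cbnd; last exact: measurableT_comp.
by rewrite -integral_itv_bndo_bndc //; exact: measurableT_comp.
Qed.

Lemma integrable_poly_weight (Q : {poly R}) :
  mu.-integrable `[-1, 1] (EFin \o (fun x => Q.[x] * jacobi_weight alpha beta x)).
Proof.
apply: integrable_itv_oo_cc.
have cQ : {within `[(-1 : R), 1], continuous (fun x => `|Q.[x]|)}.
  apply: continuous_in_subspaceT => x _; apply: continuous_comp.
    exact: continuous_horner.
  exact: norm_continuous.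
have lt11 : -1 <= (1 : R) by lra.
have [c _ cmax] := EVT_max lt11 cQ.
have : mu.-integrable `]-1, 1[
    (fun x => (`|Q.[c]|)%:E * (jacobi_weight alpha beta x)%:E)%E.
  by apply: integrableZl => //; exact: integrable_jacobi_weight.
apply: le_integrable => //.
  apply/measurable_EFinP; apply: measurable_funM.
    apply: continuous_oo_measurable => x _; exact: continuous_horner.
  exact: measurable_jacobi_weight.
move=> x /=; rewrite in_itv /= => x1.
rewrite lee_fin !normrM normr_id; apply: ler_wpM2r => //.
by apply: cmax; rewrite in_itv /= !ltW //; lra.
Qed.

Definition jacobi_functional (Q : {poly R}) : R :=
  \int[mu]_(x in `[-1, 1]) (Q.[x] * jacobi_weight alpha beta x).

Lemma jacobi_functional_linear (c : R) (A B : {poly R}) :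
  jacobi_functional (c *: A + B) = c * jacobi_functional A + jacobi_functional B.
Proof.
have iA : mu.-integrable `[-1, 1]
    (EFin \o (fun x => c * (A.[x] * jacobi_weight alpha beta x))).
  have := integrable_poly_weight (c *: A); apply: eq_integrable => // x _ /=.
  by congr EFin; rewrite hornerZ; ring.
have iA1 := integrable_poly_weight A; have iB := integrable_poly_weight B.
rewrite /jacobi_functional -RintegralZl // -RintegralD //.
by apply: eq_Rintegral => x _; rewrite hornerD hornerZ; ring.
Qed.

Lemma jacobi_functional_ge0 (Q : {poly R}) :
  (forall x : R, -1 <= x <= 1 -> 0 <= Q.[x]) -> 0 <= jacobi_functional Q.
Proof.
move=> Q0; apply: Rintegral_ge0 => x /=; rewrite in_itv /= => /Q0 Qx.
by rewrite mulr_ge0 ?jacobi_weight_ge0.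
Qed.

Lemma jacobi_functional_orth (p : nat -> {poly R}) i j :
  orthonormal_jacobi alpha beta p -> jacobi_functional (p i * p j) = (i == j)%:R.
Proof.
by move=> [_ _ <-]; apply: eq_Rintegral => x _; rewrite hornerM.
Qed.

End jacobi_functional.

(** * Effect of subtracting a polynomial on the series of best approximations *)

Section perturbation.
Context (R : realType).
Variables (gamma delta : R).
Implicit Types (f g : R -> R) (Q : {poly R}).

Local Notation norm := (weighted_norm gamma delta).
Local Notation E := (best_approx gamma delta).
Local Notation "'BS'" := (best_approx_sum gamma delta).

Definition best_approx_tail f n : R := limn (BS f) - BS f n.
Local Notation tail := best_approx_tail.

Lemma best_approx_sum_split f m n : (0 < m <= n)%N ->
  BS f n = BS f m + \sum_(m <= k < n) E k f / k.+1%:R.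
Proof.
move=> /andP[m0 mn].
by rewrite /best_approx_sum /= (@big_cat_nat _ _ _ m).
Qed.

Lemma best_approx_sum_le_tail f m n : cvgn (BS f) -> (0 < m <= n)%N ->
  \sum_(m <= k < n) E k f / k.+1%:R <= tail f m.
Proof.
move=> cf mn; rewrite /tail lerBrDl -best_approx_sum_split //.
exact: best_approx_sum_le_lim.
Qed.

Lemma best_approx_tail_nonincr f m n : cvgn (BS f) -> (m <= n)%N ->
  tail f n <= tail f m.
Proof.
move=> cf mn; rewrite /tail lerD2l lerN2.
exact: (@best_approx_sum_nondecr _ gamma delta f).
Qed.

(** Subtracting a polynomial of degree at most N leaves E_k unchanged for k >= N, so those terms are
    bounded by the tail of the series of f. *)
Lemma best_approx_sumB_le f Q N n : cvgn (BS f) -> (0 < N)%N ->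
  (size Q <= N.+1)%N ->
  BS (fun x => f x - Q.[x]) n <= BS (fun x => f x - Q.[x]) N + tail f N.
Proof.
move=> cf N0 sQ; have t0 : 0 <= tail f N.
  by rewrite subr_ge0; exact: best_approx_sum_le_lim.
have [nN|/ltnW Nn] := leqP n N.
  rewrite ler_wpDr //.
  exact: (@best_approx_sum_nondecr _ gamma delta (fun x => f x - Q.[x])).
rewrite (@best_approx_sum_split _ N n) ?N0 // lerD2l.
have NN : (0 < N <= n)%N by rewrite N0.
apply: le_trans (best_approx_sum_le_tail cf NN).
apply: ler_sum_nat => k /andP[Nk _].
by rewrite best_approx_sub_poly // (leq_trans sQ).
Qed.

Lemma B0_spaceB_poly f Q : B0_space gamma delta f ->
  B0_space gamma delta (fun x => f x - Q.[x]).
Proof.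
move=> [Cf cf]; split; first by apply: C0_spaceB => //; exact: C0_space_poly.
apply: nondecreasing_is_cvgn; first exact: best_approx_sum_nondecr.
have sQ : (size Q <= (size Q).+1.+1)%N by rewrite ltnW.
exists (BS (fun x => f x - Q.[x]) (size Q).+1 + tail f (size Q).+1).
by move=> _ [n _ <-]; exact: best_approx_sumB_le.
Qed.

(** The terms with k < N are bounded by the norm of f - Q, which produces the harmonic sum, that is
    the factor log n of the residual. *)
Lemma B0_normB_poly_le f Q N : B0_space gamma delta f -> (0 < N)%N ->
  (size Q <= N.+1)%N ->
  B0_norm gamma delta (fun x => f x - Q.[x]) <=
  norm (fun x => f x - Q.[x]) * (1 + \sum_(1 <= k < N) k.+1%:R^-1) + tail f N.
Proof.
move=> Bf N0 sQ; have [_ cg] := B0_spaceB_poly Q Bf; have [_ cf] := Bf.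
set g := (fun x => f x - Q.[x]) in cg *.
rewrite /B0_norm mulrDr mulr1 -addrA lerD2l.
apply: (@le_trans _ _ (BS g N + tail f N)).
  apply: limr_le => //; apply: nearW => n; exact: best_approx_sumB_le.
rewrite lerD2r /best_approx_sum /= mulr_sumr; apply: ler_sum_nat => k _.
by apply: ler_wpM2r; rewrite ?invr_ge0 //; exact: best_approx_le_norm.
Qed.

(** The n terms n <= k < 2n are each at least E_(2n) / (2n). This is how E_n -> 0 is extracted from
    the convergence of the series. *)
Lemma best_approx_double f n : cvgn (BS f) -> (0 < n)%N ->
  E (n + n) f <= 2 * tail f n.
Proof.
move=> cf n0; have nn : (0 < n <= n + n)%N by rewrite n0 leq_addr.
apply: le_trans (ler_wpM2l _ (best_approx_sum_le_tail cf nn)) => //.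
apply: (@le_trans _ _ (2 * \sum_(n <= k < n + n) (E (n + n) f / (n + n)%:R))).
  rewrite sumr_const_nat addnK -mulr_natr natrD.
  rewrite le_eqVlt; apply/orP; left; apply/eqP; field.
  by rewrite -natrD pnatr_eq0 addn_eq0 andbb -lt0n.
apply: ler_wpM2l => //; apply: ler_sum_nat => k /andP[k1 k2].
apply: ler_pM; rewrite ?best_approx_ge0 ?invr_ge0 //.
  by apply: best_approx_nonincr; exact: ltnW.
by rewrite lef_pV2 ?posrE ?ltr0n ?ler_nat // addn_gt0 n0.
Qed.

Lemma best_approx_tail_small f (z : R) : cvgn (BS f) -> 0 < z ->
  exists2 n, (0 < n)%N & tail f n <= z.
Proof.
move=> cf z0; have /cvgrPdist_le /(_ z z0) [n _ nP] := cf.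
exists n.+1 => //; apply: le_trans (nP n.+1 _) => //=.
exact: ler_norm.
Qed.

(* The harmonic sum is split at M and d; on [M, d) one uses E_d(f) <= E_k(f). *)
Lemma best_approx_harmonic f d M N J : cvgn (BS f) -> (0 < M)%N ->
  (M <= d)%N -> (N <= J * d)%N ->
  E d f * \sum_(1 <= k < N) k.+1%:R^-1 <= E d f * (M + J)%:R + tail f M.
Proof.
move=> cf M0 Md NJ; have E0 := best_approx_ge0 gamma delta d f.
have d0 : (0 < d)%N by exact: leq_trans Md.
have J0 : (d <= maxn (J * d) d)%N by rewrite leq_maxr.
apply: (@le_trans _ _ (E d f * (\sum_(1 <= k < M) k.+1%:R^-1 +
    \sum_(M <= k < d) k.+1%:R^-1 + \sum_(d <= k < maxn (J * d) d) k.+1%:R^-1))).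
  apply: ler_wpM2l => //; rewrite -!big_cat_nat //=.
  have N1 : (1 <= maxn (J * d) d)%N by rewrite (leq_trans d0).
  have [N0|N0] := leqP N 0; first by rewrite big_geq ?sumr_ge0 // (leq_trans N0).
  rewrite [leRHS](@big_cat_nat _ _ _ N) //=.
    by rewrite lerDl; apply: sumr_ge0 => k _; rewrite invr_ge0.
  by rewrite (leq_trans NJ) // leq_maxl.
rewrite !mulrDr natrD mulrDr addrAC; apply: lerD; first apply: lerD.
- apply: ler_wpM2l => //; apply: (@le_trans _ _ (\sum_(1 <= k < M) 1)).
    by apply: ler_sum_nat => k _; rewrite invf_le1 ?ltr0n // ler1n.
  by rewrite sumr_const_nat ler_nat leq_subr.
- apply: ler_wpM2l => //.
  apply: (@le_trans _ _ (\sum_(d <= k < maxn (J * d) d) d%:R^-1)).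
    apply: ler_sum_nat => k /andP[dk _].
    by rewrite lef_pV2 ?posrE ?ltr0n // ler_nat leqW.
  rewrite sumr_const_nat -[leLHS]mulr_natl ler_pdivrMr ?ltr0n // -natrM ler_nat.
  by rewrite leq_subLR geq_max leq_addl leq_addr.
- have MM : (0 < M <= d)%N by rewrite M0.
  apply: le_trans (best_approx_sum_le_tail cf MM).
  rewrite mulr_sumr; apply: ler_sum_nat => k /andP[_ kd].
  by apply: ler_wpM2r; rewrite ?invr_ge0 // best_approx_nonincr // ltnW.
Qed.

End perturbation.

(** * Error of the quadrature rule *)

Lemma pos_part_ge0 (R : realType) (c : R) : 0 <= pos_part c.
Proof. by rewrite /pos_part le_max lexx. Qed.

Lemma finite_hilbert_B0_bound (R : realType) (a b : R) : -1 < a -> -1 < b ->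
  exists2 C : R, 0 <= C & forall (g : R -> R) (t : R),
    B0_space (pos_part a) (pos_part b) g -> -1 < t < 1 ->
    cvg (truncated_hilbert a b g t eps @[eps --> 0^'+]) /\
    `|finite_hilbert a b g t| * u_two a b t <=
      C * B0_norm (pos_part a) (pos_part b) g.
Proof.
move=> ha hb; have [C C0 H] := finite_hilbert_bound ha hb.
(* With B the norm of g in the space, M <= B and the sum of the errors is at most 2 B plus an
   arbitrarily small slack. *)
exists (3 * C); first by rewrite mulr_ge0.
move=> g t Bg t1; have [[cg _ _] cs] := Bg.
have hA := pos_part_ge0 a; have hB := pos_part_ge0 b.
split.
  have [P [e apx]] := B0_approximants hA hB ltr01 Bg.
  by case: (H _ _ _ _ _ _ apx cg t1).
apply/ler_addgt0Pr => z z0.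
have z'0 : 0 < z / (C + 1) by rewrite divr_gt0 // ltr_wpDl.
have [P [e apx]] := B0_approximants hA hB z'0 Bg.
have [_ h] := H _ _ _ _ _ _ apx cg t1.
apply: le_trans h _.
set B := B0_norm _ _ _; set M := weighted_norm _ _ _.
have MB : M <= B.
  rewrite /B /B0_norm lerDl.
  apply: le_trans (best_approx_sum_le_lim 0 cs).
  by rewrite /best_approx_sum /= big_geq.
apply: (@le_trans _ _ (C * (3 * B + z / (C + 1)))).
  by apply: ler_wpM2l => //; lra.
have : C * (z / (C + 1)) <= z.
  rewrite mulrCA ger_pMr // ler_pdivrMr ?mul1r ?lerDl //.
  by rewrite ltr_wpDl.
lra.
Qed.

Lemma truncated_hilbertB (R : realType) (a b : R) (f g : R -> R) (t eps : R)
    P e M S P' e' M' S' : -1 < a -> -1 < b ->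
  approximants (u_plus a b) f P e M S -> approximants (u_plus a b) g P' e' M' S' ->
  {in `](-1 : R), 1[, continuous f} -> {in `](-1 : R), 1[, continuous g} ->
  0 < eps ->
  truncated_hilbert a b (fun x => f x - g x) t eps =
  truncated_hilbert a b f t eps - truncated_hilbert a b g t eps.
Proof.
move=> ha hb apf apg cf cg e0.
have cfg : {in `](-1 : R), 1[, continuous (fun x => f x - g x)}.
  by move=> x x1; apply: continuousB; [exact: cf|exact: cg].
have E h : {in `](-1 : R), 1[, continuous h} -> truncated_hilbert a b h t eps =
    \int[lebesgue_measure]_(x in [set x | -1 < x < 1 /\ eps <= `|x - t|])
      hilbert_kernel a b h t x.
  by move=> ch; exact: Rintegral_kernel_oo.
rewrite (E _ cfg) (E _ cf) (E _ cg).
set A := [set x | _ /\ _].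
have mA : measurable A.
  rewrite (_ : A = `]-1, 1[ `&` [set x | `|x - t| \in `[eps, +oo[]).
    by apply: measurableI => //; exact: measurable_normB_itv.
  by apply/seteqP; split => x /=; rewrite !in_itv /= andbT.
have A1 : A `<=` `](-1 : R), 1[ by move=> x [x1 _] /=; rewrite in_itv.
have Ae x : A x -> eps <= `|x - t| by case.
rewrite -RintegralB //.
- by apply: eq_Rintegral => x _; rewrite /hilbert_kernel; ring.
- exact: (integrable_kernel ha hb apf cf e0 mA A1 Ae).
- exact: (integrable_kernel ha hb apg cg e0 mA A1 Ae).
Qed.

(** Additivity of the limits requires their existence, known for f and for f - Q, both in the space;
    the truncated transform of Q is then the difference of the other two. *)
Lemma finite_hilbertB_poly (R : realType) (a b : R) (f : R -> R) (Q : {poly R})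
    (t : R) : -1 < a -> -1 < b ->
  B0_space (pos_part a) (pos_part b) f -> -1 < t < 1 ->
  finite_hilbert a b f t - finite_hilbert a b (horner Q) t =
  finite_hilbert a b (fun x => f x - Q.[x]) t.
Proof.
move=> ha hb Bf t1; have [C _ H] := finite_hilbert_B0_bound ha hb.
have hA := pos_part_ge0 a; have hB := pos_part_ge0 b.
have Bg := B0_spaceB_poly Q Bf; set g := (fun x => f x - Q.[x]) in Bg *.
have [P [e apf]] := B0_approximants hA hB ltr01 Bf.
have [P' [e' apg]] := B0_approximants hA hB ltr01 Bg.
have [[cf _ _] _] := Bf; have [[cg _ _] _] := Bg.
have [Hf _] := H _ _ Bf t1; have [Hg _] := H _ _ Bg t1.
have -> : finite_hilbert a b (horner Q) t =
    finite_hilbert a b f t - finite_hilbert a b g t.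
  rewrite -[LHS]/(lim (truncated_hilbert a b (horner Q) t eps @[eps --> 0^'+])).
  apply/cvg_lim; first exact: (@Rhausdorff R).
  apply: cvg_trans (cvgB Hf Hg); apply: near_eq_cvg; near=> eps.
  have e0 : 0 < eps by [].
  rewrite !fctE -(truncated_hilbertB t ha hb apf apg cf cg e0).
  congr truncated_hilbert; apply/funext => x /=; rewrite /g; ring.
by rewrite opprB addrC subrK.
Unshelve. all: by end_near. Qed.

(** * The residual of the de la Vallee Poussin operator *)

Section vallee_poussin.
Context (R : realType).
Variables (alpha beta : R) (p : nat -> {poly R}).
Hypotheses (halpha : -1 < alpha) (hbeta : -1 < beta).
Hypothesis hp : orthonormal_jacobi alpha beta p.

Let size_p j : size (p j) = j.+1. Proof. by case: hp. Qed.
Let L_linear := jacobi_functional_linear halpha hbeta.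
Let L_ge0 := @jacobi_functional_ge0 R alpha beta.
Let L_orth i j := jacobi_functional_orth i j hp.

Lemma vp_error_bound (a b : R) : -1 < a -> -1 < b ->
  exists2 C : R, 0 <= C & forall n m (f : R -> R) (t : R),
    B0_space (pos_part a) (pos_part b) f -> -1 < t < 1 ->
    vp_error a b p n m f t * u_two a b t <=
    C * B0_norm (pos_part a) (pos_part b) (fun x => f x - vp_operator p n m f x).
Proof.
move=> ha hb; have [C C0 H] := finite_hilbert_B0_bound ha hb.
exists C => // n m f t Bf t1.
have [Q [_ VQ]] := vp_operator_poly size_p L_linear L_ge0 L_orth n m f.
rewrite /vp_error /vp_quadrature VQ finite_hilbertB_poly //.
have Bg := B0_spaceB_poly Q Bf.
by case: (H _ _ Bg t1).
Qed.

Variables (gamma delta : R) (hg : 0 <= gamma) (hd : 0 <= delta).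
Local Notation norm := (weighted_norm gamma delta).
Local Notation E := (best_approx gamma delta).

(** Lebesgue's argument: the operator fixes a near-best Q of degree n - m, so the residuals of f and
    of h = f - Q coincide, and the latter is bounded by (1 + C) times the norm of h. *)
Lemma vp_residual_norm_le n m (C : R) f : 0 < C -> (0 < m)%N -> (m < n)%N ->
  (forall h, C0_space gamma delta h ->
     norm (vp_operator p n m h) <= C * norm h) ->
  C0_space gamma delta f ->
  norm (fun x => f x - vp_operator p n m f x) <= (1 + C) * E (n - m) f.
Proof.
move=> C0 m0 mn VC Cf; apply/ler_addgt0Pr => z z0.
have z'0 : 0 < z / (1 + C) by rewrite divr_gt0 // addr_gt0.
have [Q [sQ lt]] := best_approx_lt gamma delta (n - m) f z'0.
have Ch := C0_spaceB Cf (C0_space_poly gamma delta Q).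
set h := (fun x => f x - Q.[x]) in Ch lt.
have [Q' [_ VQ']] := vp_operator_poly size_p L_linear L_ge0 L_orth n m h.
apply: (@le_trans _ _ ((1 + C) * norm h)); last first.
  apply: (@le_trans _ _ ((1 + C) * (E (n - m) f + z / (1 + C)))).
    by apply: ler_wpM2l; [rewrite addr_ge0 // ltW|exact: ltW].
  rewrite mulrDr lerD2l mulrCA divff ?mulr1 //.
  by rewrite gt_eqF // addr_gt0.
apply: weighted_norm_le => x x1.
have -> : f x - vp_operator p n m f x = h x - vp_operator p n m h x.
  rewrite (vp_operatorB size_p L_linear L_ge0 L_orth).
  rewrite (vp_operator_id size_p L_linear L_ge0 L_orth _ m0 mn sQ) /h; ring.
have w0 := jacobi_weight_ge0 gamma delta x.
apply: (@le_trans _ _ (`|h x| * jacobi_weight gamma delta x +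
  `|vp_operator p n m h x| * jacobi_weight gamma delta x)).
  by rewrite -mulrDl ler_wpM2r // ler_normB.
rewrite mulrDl mul1r; apply: lerD; first exact: weighted_norm_ge.
apply: le_trans (VC h Ch); rewrite VQ'.
apply: (@weighted_norm_ge _ _ _ hg hd (fun x => Q'.[x])) => //.
exact: C0_space_poly.
Qed.

Lemma vp_residual_cvg (c1 c2 C : R) f : 1 < c1 -> 0 < C ->
  (forall n m h, vp_related c1 c2 n m -> C0_space gamma delta h ->
     norm (vp_operator p n m h) <= C * norm h) ->
  B0_space gamma delta f -> forall z : R, 0 < z ->
  \forall n \near \oo, forall m, vp_related c1 c2 n m ->
    B0_norm gamma delta (fun x => f x - vp_operator p n m f x) <= z.
Proof.
move=> hc1 C0 VC Bf z z0; have [Cf cf] := Bf.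
(* From m <= n / c1 follows n - m >= th n. So n - m tends to infinity with n, and n + m <= 2 n <= J
   (n - m) for the J below. *)
pose th : R := 1 - c1^-1.
have c10 : 0 < c1 by lra.
have ci : c1^-1 < 1 by rewrite invf_lt1.
have th0 : 0 < th by rewrite subr_gt0.
pose J := (Num.truncn (2 / th)).+1.
have J_ge : 2 / th <= J%:R by apply/ltW/truncnS_gt.
have z1 : 0 < z / (4 * (1 + C)) by rewrite divr_gt0 ?mulr_gt0 ?addr_gt0.
have [M M0 tM] := best_approx_tail_small cf z1.
(* The order of choices matters: M is fixed by the tail and determines X, the factor in front of
   E_(n-m); only then is M' taken so large that this product is small. *)
pose X : R := (1 + C) * (1 + (M + J)%:R).
have X0 : 0 < X by apply: mulr_gt0; [exact: addr_gt0|rewrite ltr_wpDr].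
have z2 : 0 < z / (4 * X) by rewrite divr_gt0 // mulr_gt0.
have [M' M'0 tM'] := best_approx_tail_small cf z2.
pose d0 := maxn M (M' + M').
exists (Num.truncn (d0%:R / th)).+1 => // n /= nn m rel.
have [m0 mn c1m _] := rel.
have d_ge : th * n%:R <= (n - m)%:R.
  rewrite natrB; last exact: ltnW.
  have : m%:R <= c1^-1 * n%:R by rewrite ler_pdivlMl.
  by rewrite /th; lra.
have d0d : (d0 <= n - m)%N.
  rewrite -(ler_nat R); apply: le_trans d_ge.
  rewrite mulrC -ler_pdivrMr //; apply/ltW/(lt_le_trans (truncnS_gt _)).
  by rewrite ler_nat.
have Md : (M <= n - m)%N by apply: leq_trans d0d; exact: leq_maxl.
have NJ : (n + m <= J * (n - m))%N.
  rewrite -(ler_nat R) natrM natrD.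
  apply: (@le_trans _ _ (2 / th * (n - m)%:R)); last exact: ler_wpM2r.
  rewrite mulrAC ler_pdivlMr //.
  have mn' : m%:R <= n%:R :> R by rewrite ler_nat ltnW.
  apply: (@le_trans _ _ (2 * (th * n%:R))); last by lra.
  have : th * (n%:R + m%:R) <= th * (2 * n%:R) by apply: ler_wpM2l; lra.
  lra.
have Ed : E (n - m) f <= 2 * (z / (4 * X)).
  apply: (@le_trans _ _ (E (M' + M') f)).
    by apply: best_approx_nonincr; apply: leq_trans d0d; exact: leq_maxr.
  by apply: le_trans (best_approx_double cf M'0) _; lra.
have [Q [sQ VQ]] := vp_operator_poly size_p L_linear L_ge0 L_orth n m f.
have nm0 : (0 < n + m)%N by rewrite addn_gt0 m0 orbT.
have := @B0_normB_poly_le _ _ _ f Q (n + m) Bf nm0.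
rewrite -VQ => /(_ (leqW sQ)) H; apply: le_trans H _.
have res := vp_residual_norm_le C0 m0 mn (VC n m ^~ rel) Cf.
have harm := best_approx_harmonic cf M0 Md NJ.
have tn : best_approx_tail gamma delta f (n + m) <= z / (4 * (1 + C)).
  apply: le_trans tM; apply: best_approx_tail_nonincr => //.
  by rewrite (leq_trans Md) // (leq_trans (leq_subr m n)) // leq_addr.
set T := \sum_(1 <= k < n + m) _ in harm *.
have T0 : 0 <= T by apply: sumr_ge0 => k _; rewrite invr_ge0.
apply: (@le_trans _ _ ((1 + C) * (E (n - m) f * (1 + (M + J)%:R) +
   z / (4 * (1 + C))) + z / (4 * (1 + C)))).
  apply: lerD => //.
  apply: (@le_trans _ _ ((1 + C) * E (n - m) f * (1 + T))).
    by apply: ler_wpM2r => //; rewrite addr_ge0.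
  rewrite -mulrA; apply: ler_wpM2l; first by lra.
  lra.
(* The budget is z / 2 for E_(n-m) X, z / 4 for the tail from the harmonic sum, and z / 4 for the
   tail beyond n + m. *)
have -> : (1 + C) * (E (n - m) f * (1 + (M + J)%:R) + z / (4 * (1 + C))) =
   E (n - m) f * X + z / 4 by rewrite /X; field; rewrite gt_eqF // addr_gt0.
have : E (n - m) f * X <= 2 * (z / (4 * X)) * X by apply: ler_wpM2r => //; exact: ltW.
have -> : 2 * (z / (4 * X)) * X = z / 2 by field; rewrite gt_eqF.
have : z / (4 * (1 + C)) <= z / 4.
  apply: ler_wpM2l; first exact: ltW.
  by rewrite lef_pV2 ?posrE ?mulr_gt0 ?addr_gt0 //; lra.
lra.
Qed.

End vallee_poussin.

Unset Implicit Arguments.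

Theorem theorem4p2 (R : realType) (a b alpha beta c1 c2 : R)
    (p : nat -> {poly R}) (ha : -1 < a) (hb : -1 < b)
    (halpha : -1 < alpha) (hbeta : -1 < beta)
    (hp : orthonormal_jacobi alpha beta p) (hc1 : 1 < c1) (hc2 : c1 <= c2) :
  (exists2 C : R, 0 < C &
     forall (n m : nat) (f : R -> R) (t : R),
       vp_related c1 c2 n m ->
       B0_space (pos_part a) (pos_part b) f ->
       -1 < t < 1 ->
       vp_error a b p n m f t * u_two a b t <=
         C * (`|f t - vp_operator p n m f t| * u_one a b t)
         + C * B0_norm (pos_part a) (pos_part b)
                 (fun x => f x - vp_operator p n m f x))
  /\
  ((exists2 C : R, 0 < C &
      forall (n m : nat) (f : R -> R),
        vp_related c1 c2 n m ->
        C0_space (pos_part a) (pos_part b) f ->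
        weighted_norm (pos_part a) (pos_part b) (vp_operator p n m f)
          <= C * weighted_norm (pos_part a) (pos_part b) f) ->
   forall f : R -> R, B0_space (pos_part a) (pos_part b) f ->
   forall e : R, 0 < e ->
   \forall n \near \oo, forall (m : nat) (t : R),
     vp_related c1 c2 n m -> -1 < t < 1 ->
     vp_error a b p n m f t * u_two a b t < e).
Proof.
have [C C0 H] := vp_error_bound halpha hbeta hp ha hb.
(* C is only known to be nonnegative, whereas the constant to be produced is positive. *)
have C10 : 0 < C + 1 by rewrite ltr_wpDl.
have hA := pos_part_ge0 a; have hB := pos_part_ge0 b.
split.
  exists (C + 1) => // n m f t _ Bf t1.
  apply: le_trans (H n m f t Bf t1) _; rewrite -[leLHS]add0r; apply: lerD.
    apply: mulr_ge0; first exact: ltW.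
    by apply: mulr_ge0 => //; exact: jacobi_weight_ge0.
  apply: ler_wpM2r; last by rewrite lerDl.
  have [Q [_ ->]] := vp_operator_poly
    (let: And3 h _ _ := hp in h) (jacobi_functional_linear halpha hbeta)
    (@jacobi_functional_ge0 R alpha beta)
    (fun i j => jacobi_functional_orth i j hp) n m f.
  by have [_ cg] := B0_spaceB_poly Q Bf; exact: B0_norm_ge0.
move=> [D D0 VD] f Bf e e0.
have z0 : 0 < e / (C + 1) / 2 by rewrite !divr_gt0.
have := vp_residual_cvg halpha hbeta hp hA hB hc1 D0 VD Bf z0.
apply: filterS => n nP m t rel t1.
apply: le_lt_trans (H n m f t Bf t1) _.
apply: (@le_lt_trans _ _ (C * (e / (C + 1) / 2))).
  by apply: ler_wpM2l => //; exact: nP.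
have -> : C * (e / (C + 1) / 2) = e * (C / (C + 1) / 2) by ring.
rewrite gtr_pMr // ltr_pdivrMr // mul1r ltr_pdivrMr //; lra.
Qed.
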